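(* Let $\alpha\in(0,1)$, $p\in[1,2]$, let $(\omega_n)_{n\ge0}$ be a bounded positive weight sequence, and assume that the sequence $(k_n)_{n\ge0}$ defined by $k_0>0$ and $$k_n:=k_0\prod_{l=0}^{n-1}\frac1{\omega_l},\quad n\ge1,$$ satisfies $(k_n)_{n\ge0}\in\ell^\alpha(\mathbb{N})$. Let $\mu$ be the distribution on the complex Banach space $\ell^p(\mathbb{N})$ of the random series $$\sum_{n=0}^\infty k_n(\theta_{1,n}+i\theta_{2,n})e_n,$$ where $(\theta_{1,n})_{n\ge0}$, $(\theta_{2,n})_{n\ge0}$ are independent copies of the tempered stable random variable $\theta$ with parameters $\alpha,a_-,a_+,\lambda_-,\lambda_+$ (see context), and consider the bounded weighted backward shift operator $T$ on $\ell^p(\mathbb{N})$ defined by $$Te_0:=0,\qquad Te_{n+1}:=\omega_ne_n,\quad n\ge0.$$ Then: 1. $T$ admits $\mu$ as invariant measure. 2. For each of $C_\mu^{=,\neq}=C_\mu^{=}$ and $C_\mu^{=,\neq}=C_\mu^{\neq}$, and all $n\ge0$, $$\sup_{x^*,y^*\in(\ell^p(\mathbb{N}))^*\setminus\{0\}}\frac{|C_\mu^{=,\neq}(x^*,T^{*n}y^* )|}{\|x^*\|^{p/2}\|y^*\|^{p/2}}\le2^{5-p}\big(a_-\lambda_-^{\alpha-p}+a_+\lambda_+^{\alpha-p}\big)\Gamma(p-\alpha)\sum_{l=0}^\infty k_l^{p/2}k_{l+n}^{p/2}.$$ In particular, $T$ is mixing with respect to $\mu$ provided that $\lim_{n\to\infty}\sum_{l=0}^\infty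 k_l^{p/2}k_{l+n}^{p/2}=0$.
   Context: Tempered stable variable: for $\alpha\in(0,1)$ and $a_-,a_+,\lambda_-,\lambda_+>0$, $\theta$ is a real random variable with characteristic function $$\mathbb{E}[e^{it\theta}]=\exp\Big(\int_{\mathbb{R}}\big(e^{itx}-1-i\kappa(x)tx\big)\lambda(dx)\Big),\ t\in\mathbb{R},\qquad \kappa(x)=\mathbf{1}_{\{|x|<1\}}+\frac1{|x|}\mathbf{1}_{\{|x|\ge1\}},$$ $$\lambda(dx)=a_-\frac{e^{-\lambda_-|x|}}{|x|^{1+\alpha}}\mathbf{1}_{\mathbb{R}^-}(x)\,dx+a_+\frac{e^{-\lambda_+x}}{x^{1+\alpha}}\mathbf{1}_{\mathbb{R}^+}(x)\,dx.$$ All $\theta_{1,n},\theta_{2,n}$, $n\ge0$, are independent and identically distributed as $\theta$. $(e_n)_{n\ge0}$ is the canonical basis of $\ell^p(\mathbb{N})$. Write $E=\ell^p(\mathbb{N})$, $\langle\cdot,\cdot\rangle:E\times E^*\to\mathbb{C}$ for the duality, $T^*$ for the adjoint, $\langle z,T^*x^*\rangle=\langle Tz,x^*\rangle$. Codifferences: for $x^*,y^*\in E^*$, $$C^{=}_\mu(x^*,y^* ):=\log\int_E e^{i\mathrm{Re}\langle z,x^*-y^*\rangle}\mu(dz)-\log\int_E e^{i\mathrm{Re}\langle z,x^*\rangle}\mu(dz)-\log\int_E e^{-i\mathrm{Re}\langle z,y^*\rangle}\mu(dz),$$ $$C^{\neq}_\mu(x^*,y^* ):=\log\int_E e^{i\mathrm{Re}\langle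 z,x^*\rangle-i\mathrm{Im}\langle z,y^*\rangle}\mu(dz)-\log\int_E e^{i\mathrm{Re}\langle z,x^*\rangle}\mu(dz)-\log\int_E e^{-i\mathrm{Im}\langle z,y^*\rangle}\mu(dz),$$ where $\log$ of the (non-vanishing) characteristic functional $x^*\mapsto\int_E e^{i\mathrm{Re}\langle z,x^*\rangle}\mu(dz)$ is its Lévy–Khintchine exponent (the continuous logarithm vanishing at $x^*=0$); note $-\mathrm{Im}\langle z,y^*\rangle=\mathrm{Re}\langle z,iy^*\rangle$. $T$ admits $\mu$ as invariant measure if $\mu(T^{-1}(A))=\mu(A)$ for all Borel $A\subset E$. $T$ is mixing if $\lim_{n\to\infty}\mu(A\cap T^{-n}(B))=\mu(A)\mu(B)$ for all Borel $A,B\subset E$. *)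

(* Defs.v *)
From HB Require Import structures.
From mathcomp Require Import all_boot all_order all_algebra.
From mathcomp Require Import all_classical all_reals all_analysis.
From mathcomp Require Import complex ring.

Set Implicit Arguments.
Unset Strict Implicit.
Unset Printing Implicit Defensive.

Import Order.TTheory GRing.Theory Num.Theory.
Import numFieldNormedType.Exports.

Local Open Scope classical_set_scope.
Local Open Scope complex_scope.
Local Open Scope ring_scope.

(* Norms of normed modules over R[i] take their values in R[i]; [rnorm x] is
   the same norm as an element of R. *)
Definition rnorm (R : realType) (V : normedModType R[i]) (x : V) : R :=
  complex.Re `|x|.

Section rnorm_theory.
Context (R : realType) (V : normedModType R[i]).
Implicit Types x y : V.

Lemma rnormE x : (rnorm x)%:C = `|x|.
Proof.
by rewrite /rnorm; case: `|x| (normr_ge0 x) => a b; rewrite lecE/= => /andP[/eqP->].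
Qed.

Lemma rnorm_ge0 x : 0 <= rnorm x.
Proof. by have := normr_ge0 x; rewrite -rnormE lecR. Qed.

Lemma rnormD x y : rnorm (x + y) <= rnorm x + rnorm y.
Proof. by rewrite -lecR rmorphD/= !rnormE ler_normD. Qed.

Lemma rnormZ (a : R[i]) x : rnorm (a *: x) = rnorm (a : R[i]^o) * rnorm x.
Proof. by apply: complexI; rewrite rmorphM/= !rnormE normrZ. Qed.

Lemma rnorm0 : rnorm (0 : V) = 0.
Proof. by apply: complexI; rewrite rnormE normr0. Qed.

Lemma rnorm_eq0 x : rnorm x = 0 -> x = 0.
Proof. by move=> h; apply/normr0_eq0; rewrite -rnormE h. Qed.

End rnorm_theory.

Section ell_p.
Context (R : realType).

Definition in_lp (p : R) : {pred nat -> R[i]^o} :=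
  [pred u : nat -> R[i]^o | finite_norm counting p%:E (fun n => rnorm (u n)) ].

(* [p1] is a parameter of the type because the norm instance below (Minkowski)
   depends on it. *)
Record lp (p : R) (p1 : 1 <= p) := LpSeq {
  lp_seq :> nat -> R[i]^o ;
  lp_seqP : lp_seq \in in_lp p }.

End ell_p.
Arguments LpSeq {R p p1} _ _.

Section ell_p_structure.
Context (R : realType) (p : R) (p1 : 1 <= p).
Let E := lp p1.

HB.instance Definition _ := [isSub of E for @lp_seq R p p1].
HB.instance Definition _ := [Choice of E by <:].

Let p_gt0 : 0 < p. Proof. exact: lt_le_trans p1. Qed.

Let N (f : nat -> R) : \bar R := ('N[counting]_p%:E [EFin \o f])%E.

Let NE (f : nat -> R) : N f = ((\sum_(k <oo) ((`|f k| `^ p)%:E)) `^ p^-1)%E.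
Proof. by rewrite /N Lnorm_counting//. Qed.

Let le_N (f g : nat -> R) : (forall n, 0 <= f n <= g n) -> (N f <= N g)%E.
Proof.
move=> fg; rewrite !NE; apply: gt0_ler_poweR.
- by rewrite invr_ge0 ltW.
- by rewrite in_itv/= leey andbT; apply: nneseries_ge0 => n _ _; rewrite lee_fin powR_ge0.
- by rewrite in_itv/= leey andbT; apply: nneseries_ge0 => n _ _; rewrite lee_fin powR_ge0.
apply: lee_nneseries => [n _ _|n _]; first by rewrite lee_fin powR_ge0.
have /andP[f0 fgn] := fg n; rewrite lee_fin ge0_ler_powR ?(ltW p_gt0) ?nnegrE//.
by rewrite !ger0_norm//; apply: le_trans fgn.
Qed.

Let NZ (a : R) (f : nat -> R) : N (fun n => a * f n) = (`|a|%:E * N f)%E.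
Proof.
rewrite !NE.
have -> : (\sum_(k <oo) (`|a * f k| `^ p)%:E =
    (`|a| `^ p)%:E * \sum_(k <oo) (`|f k| `^ p)%:E)%E.
  rewrite -nneseriesZl//.
  by apply: eq_eseriesr => n _; rewrite -EFinM normrM powRM.
rewrite poweRM ?lee_fin ?powR_ge0//; last first.
  by apply: nneseries_ge0 => n _ _; rewrite lee_fin powR_ge0.
by rewrite poweR_EFin -powRrM mulfV ?gt_eqF// powRr1.
Qed.

Let N_cst0 : N (fun=> 0) = 0%E.
Proof.
have := NZ 0 (fun=> 0); rewrite normr0 mul0e => <-.
by congr N; apply/funext => n; rewrite mulr0.
Qed.

Let ND (u v : nat -> R[i]^o) :
  (N (fun n => rnorm (u n + v n)%R) <= N (fun n => rnorm (u n)) + N (fun n => rnorm (v n)))%E.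
Proof.
apply: (@le_trans _ _ (N ((fun n => rnorm (u n)) \+ (fun n => rnorm (v n))))).
  by apply: le_N => n; rewrite rnorm_ge0/= rnormD.
exact: minkowski_EFin.
Qed.

Fact in_lp_submod_closed : submod_closed (in_lp p : {pred nat -> R[i]^o}).
Proof.
split.
  rewrite inE/= /finite_norm.
  have -> : (fun n : nat => rnorm ((0 : nat -> R[i]^o) n)) = fun=> 0.
    by apply/funext => n; rewrite rnorm0.
  by rewrite -/(N _) N_cst0.
move=> a u v; rewrite !inE/= /finite_norm => fu fv.
apply: (le_lt_trans (ND (a *: u) v)).
rewrite lte_add_pinfty//.
have -> : (fun n : nat => rnorm ((a *: u) n)) = (fun n => rnorm (a : R[i]^o) * rnorm (u n)).
  by apply/funext => n; rewrite -rnormZ.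
by rewrite NZ lte_mul_pinfty// lee_fin.
Qed.

HB.instance Definition _ :=
  GRing.isSubmodClosed.Build R[i] (nat -> R[i]^o) (in_lp p) in_lp_submod_closed.
HB.instance Definition _ := [SubChoice_isSubLmodule of E by <:].

Definition lp_norm (u : E) : R :=
  fine ('N[counting]_p%:E [EFin \o (fun n => rnorm (u n))])%E.

Let lp_fin (u : E) : N (fun n => rnorm (u n)) \is a fin_num.
Proof.
rewrite ge0_fin_numE; first by have := lp_seqP u; rewrite inE.
exact: Lnorm_ge0.
Qed.

Fact lp_norm_triangle (u v : E) :
  (lp_norm (u + v))%:C <= (lp_norm u)%:C + (lp_norm v)%:C.
Proof.
rewrite -rmorphD/= lecR -lee_fin EFinD !fineK ?lp_fin//.
exact: ND.
Qed.

Fact lp_norm_scale (a : R[i]) (u : E) :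
  (lp_norm (a *: u))%:C = `|a| * (lp_norm u)%:C.
Proof.
rewrite -(rnormE (a : R[i]^o)) -rmorphM/=; congr (_%:C); apply: EFin_inj.
rewrite EFinM !fineK ?lp_fin//.
rewrite -[in RHS](ger0_norm (rnorm_ge0 (a : R[i]^o))) -NZ.
by congr N; apply/funext => n; rewrite -rnormZ.
Qed.

Fact lp_norm_eq0 (u : E) : (lp_norm u)%:C = 0 -> u = 0.
Proof.
move=> /complexI u0; apply: val_inj; apply/funext => n.
apply: rnorm_eq0.
have : N (fun n => rnorm (u n)) = 0%E by rewrite -(fineK (lp_fin u)) [fine _]u0.
have nn k : (0 <= (`|rnorm (u k)| `^ p)%:E)%E by rewrite lee_fin powR_ge0.
rewrite NE => /(poweR_eq0_eq0 (nneseries_ge0 (fun k _ _ => nn k))) s0.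
have /= := nneseries_lim_ge n.+1 (fun k (_ : (0 <= k)%N) (_ : xpredT k) => nn k).
rewrite s0 big_nat_recr//= => h.
have {h} : ((`|rnorm (u n)| `^ p)%:E <= 0)%E.
  by apply: le_trans h; rewrite leeDr// sume_ge0.
rewrite lee_fin => h; have /powR_eq0_eq0/normr0_eq0 // : `|rnorm (u n)| `^ p = 0.
by apply/eqP; rewrite eq_le h powR_ge0.
Qed.

HB.instance Definition _ :=
  Lmodule_isNormed.Build R[i] E lp_norm_triangle lp_norm_scale lp_norm_eq0.

Fact lp_basis_subproof (n : nat) :
  (fun m => (m == n)%:R : R[i]^o) \in in_lp p.
Proof.
rewrite inE/= /finite_norm -/(N _) NE.
rewrite (nneseries_split 0 n.+1)/=; last by move=> k _; rewrite lee_fin powR_ge0.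
rewrite [X in (_ + X)%E]eseries0 ?adde0; last first.
  move=> k; rewrite add0n => nk _.
  by rewrite gtn_eqF// rnorm0 normr0 powR0// gt_eqF.
by rewrite add0n sumEFin poweR_EFin ltry.
Qed.

Definition lp_basis (n : nat) : E := LpSeq _ (lp_basis_subproof n).

End ell_p_structure.
Arguments lp_basis {R p} p1 n.

Section dual_space.
Context (R : realType) (E : normedModType R[i]).

Definition in_dual : {pred E -> R[i]^o} :=
  [pred f : E -> R[i]^o | `[< linear f /\ continuous f >] ].

Lemma in_dualP (f : E -> R[i]^o) :
  reflect (linear f /\ continuous f) (f \in in_dual).
Proof. exact: asboolP. Qed.

Record dual := Dual { dual_fun :> E -> R[i]^o ; dual_funP : dual_fun \in in_dual }.

HB.instance Definition _ := [isSub of dual for dual_fun].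
HB.instance Definition _ := [Choice of dual by <:].

Fact in_dual_submod_closed : submod_closed (in_dual : {pred E -> R[i]^o}).
Proof.
split.
  apply/in_dualP; split; last by move=> x; exact: cvg_cst.
  by move=> a x y; rewrite /= scaler0 addr0.
move=> a f g /in_dualP[lf cf] /in_dualP[lg cg].
apply/in_dualP; split.
  move=> b x y; rewrite [LHS](_ : _ = a *: f (b *: x + y) + g (b *: x + y))//.
  rewrite lf lg [RHS](_ : _ = b *: (a *: f x + g x) + (a *: f y + g y))//.
  by rewrite !scalerDr !scalerA (mulrC b) -!addrA; congr +%R; rewrite addrCA.
move=> x; apply: (@continuousD _ _ _ (a \*: f) g); last exact: cg.
apply: cvgZl_tmp; exact: cf.
Qed.

HB.instance Definition _ :=
  GRing.isSubmodClosed.Build R[i] (E -> R[i]^o) in_dual in_dual_submod_closed.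
HB.instance Definition _ := [SubChoice_isSubLmodule of dual by <:].

Definition dual_norm (f : dual) : R :=
  sup [set rnorm (f z) | z in [set z : E | rnorm z <= 1]].

Let dual_bounded (f : dual) :
  exists2 M : R, 0 <= M & forall z : E, rnorm (f z) <= M * rnorm z.
Proof.
have /in_dualP[lf cf] := dual_funP f.
pose F : {linear E -> R[i]^o} :=
  HB.pack (f : E -> R[i]^o) (GRing.isLinear.Build _ _ _ _ (f : E -> R[i]^o) lf).
have /linear_boundedP/pinfty_ex_gt0 [M M0 FM] : bounded_near F (nbhs (0 : E)).
  by apply/linear_bounded_continuous; exact: cf.
exists (rnorm (M : R[i]^o)); first exact: rnorm_ge0.
by move=> z; rewrite -lecR rmorphM/= !rnormE (gtr0_norm M0); exact: FM.
Qed.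

Let dual_ub (f : dual) :
  has_ubound [set rnorm (f z) | z in [set z : E | rnorm z <= 1]].
Proof.
have [M M0 fM] := dual_bounded f; exists M => _ [z /= z1 <-].
by rewrite (le_trans (fM z))// ler_piMr.
Qed.

Let dual_nonempty (f : dual) :
  [set rnorm (f z) | z in [set z : E | rnorm z <= 1]] !=set0.
Proof. by exists (rnorm (f 0)), 0 => //=; rewrite rnorm0. Qed.

Let dual_norm_ge (f : dual) (z : E) : rnorm z <= 1 -> rnorm (f z) <= dual_norm f.
Proof. by move=> z1; apply: ub_le_sup => //; exists z. Qed.

Fact dual_norm_triangle (f g : dual) :
  (dual_norm (f + g))%:C <= (dual_norm f)%:C + (dual_norm g)%:C.
Proof.
rewrite -rmorphD/= lecR; apply: ge_sup => // _ [z /= z1 <-].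
by rewrite (le_trans (rnormD (f z) (g z)))// lerD// dual_norm_ge.
Qed.

Let dual_norm_scale_le (a : R[i]) (f : dual) :
  dual_norm (a *: f) <= rnorm (a : R[i]^o) * dual_norm f.
Proof.
apply: ge_sup => // _ [z /= z1 <-].
rewrite [leLHS](rnormZ a (f z)).
by rewrite ler_wpM2l ?rnorm_ge0// dual_norm_ge.
Qed.

Fact dual_norm_scale (a : R[i]) (f : dual) :
  (dual_norm (a *: f))%:C = `|a| * (dual_norm f)%:C.
Proof.
rewrite -(rnormE (a : R[i]^o)) -rmorphM/=; congr (_%:C).
apply/eqP; rewrite eq_le dual_norm_scale_le/=.
have [->|a0] := eqVneq a 0.
  rewrite scale0r (rnorm0 R[i]^o) mul0r.
  by apply: le_trans (dual_norm_ge _ (z := 0) _); rewrite ?rnorm_ge0// rnorm0.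
have na : 0 < rnorm (a : R[i]^o) by rewrite -ltcR rnormE normr_gt0.
rewrite -ler_pdivlMl// (_ : _^-1 = rnorm (a^-1 : R[i]^o)); last first.
  by apply: complexI; rewrite fmorphV/= !rnormE normfV.
by apply: le_trans (dual_norm_scale_le _ _); rewrite scalerA mulVf// scale1r.
Qed.

Fact dual_norm_eq0 (f : dual) : (dual_norm f)%:C = 0 -> f = 0.
Proof.
move=> /complexI f0; apply: val_inj; apply/funext => z.
have /in_dualP[lf _] := dual_funP f.
have fZ (a : R[i]) x : f (a *: x) = a *: f x.
  have f00 : f 0 = 0.
    by have := lf (-1) 0 0; rewrite scaler0 addr0 scaleN1r addNr.
  by have := lf a x 0; rewrite f00 !addr0.
have [z0|z0] := eqVneq z 0.
  by have := fZ 0 z; rewrite !scale0r z0.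
have nz : `|z| != 0 by rewrite normr_eq0.
apply: (scalerI (a := `|z|^-1)); first by rewrite invr_eq0.
rewrite scaler0 -fZ; apply: rnorm_eq0; apply/eqP; rewrite eq_le rnorm_ge0 andbT.
rewrite -f0 dual_norm_ge// -lecR rnormE normrZ normfV normr_id mulVf//.
Qed.

HB.instance Definition _ :=
  Lmodule_isNormed.Build R[i] dual dual_norm_triangle dual_norm_scale dual_norm_eq0.

Variables (T : {linear E -> E}) (T_cont : continuous T).

Fact adjoint_subproof (f : dual) : (f \o T : E -> R[i]^o) \in in_dual.
Proof.
have /in_dualP[lf cf] := dual_funP f.
apply/in_dualP; split; first by move=> a x y; rewrite /= linearP lf.
by move=> x; apply: continuous_comp; [exact: T_cont|exact: cf].
Qed.

Definition adjoint (f : dual) : dual := Dual (adjoint_subproof f).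

End dual_space.

Section complex_integration.
Context (R : realType).

Definition cexp (z : R[i]) : R[i] :=
  let: x +i* y := z in (expR x * cos y) +i* (expR x * sin y).

Definition cintegral d (T : measurableType d) (mu : {measure set T -> \bar R})
    (f : T -> R[i]) : R[i] :=
  (\int[mu]_x complex.Re (f x)) +i* (\int[mu]_x complex.Im (f x)).

(* The logarithm of [phi] that is continuous and vanishes at 0; it is unique
   when it exists, since [V] is connected. *)
Definition clog (V : normedModType R[i]) (phi : V -> R[i]) : V -> R[i]^o :=
  get [set L : V -> R[i]^o |
    [/\ continuous L, L 0 = 0 & forall v, cexp (L v) = phi v]].

Definition GammaR (s : R) : R :=
  \int[lebesgue_measure]_(x in `]0, +oo[) (x `^ (s - 1) * expR (- x)).

End complex_integration.

Notation borel E := (g_sigma_algebraType (@open E)).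

Section codifference.
Context (R : realType) (E : normedModType R[i]).
Variable mu : {measure set (borel E) -> \bar R}.

Definition charfunctional (x : dual E) : R[i] :=
  cintegral mu (fun z : E => cexp ('i * (complex.Re (x z))%:C)).

Definition codiff_eq (x y : dual E) : R[i] :=
  clog charfunctional (x - y) - clog charfunctional x - clog charfunctional (- y).

(* $-\mathrm{Im}\langle z,y\rangle = \mathrm{Re}\langle z,iy\rangle$, see
   [charfunctionalDi] below. *)
Definition codiff_neq (x y : dual E) : R[i] :=
  clog charfunctional (x + 'i *: y) - clog charfunctional x -
  clog charfunctional ('i *: y).

Lemma charfunctionalB (x y : dual E) : charfunctional (x - y) =
  cintegral mu (fun z : E => cexp ('i * (complex.Re (x z - y z))%:C)).
Proof. by []. Qed.

Lemma charfunctionalN (y : dual E) : charfunctional (- y) =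
  cintegral mu (fun z : E => cexp (- 'i * (complex.Re (y z))%:C)).
Proof.
congr cintegral; apply/funext => z.
rewrite (_ : (- y) z = - y z)//.
by congr cexp; case: (y z) => a b /=;
  apply/eqP; rewrite eq_complex/=; apply/andP; split; apply/eqP; ring.
Qed.

Lemma charfunctionalDi (x y : dual E) : charfunctional (x + 'i *: y) =
  cintegral mu (fun z : E =>
    cexp ('i * (complex.Re (x z))%:C - 'i * (complex.Im (y z))%:C)).
Proof.
congr cintegral; apply/funext => z.
rewrite (_ : (x + 'i *: y) z = x z + 'i * y z)//.
by congr cexp; case: (x z) (y z) => [a b] [c e] /=;
  apply/eqP; rewrite eq_complex/=; apply/andP; split; apply/eqP; ring.
Qed.

Lemma charfunctionali (y : dual E) : charfunctional ('i *: y) =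
  cintegral mu (fun z : E => cexp (- 'i * (complex.Im (y z))%:C)).
Proof.
congr cintegral; apply/funext => z.
rewrite (_ : ('i *: y) z = 'i * y z)//.
by congr cexp; case: (y z) => a b /=;
  apply/eqP; rewrite eq_complex/=; apply/andP; split; apply/eqP; ring.
Qed.

Definition normalized_sup (q : R) (C : dual E -> dual E -> R[i]) : \bar R :=
  ereal_sup [set (rnorm (C xy.1 xy.2 : R[i]^o) /
                  (rnorm xy.1 `^ q * rnorm xy.2 `^ q))%:E
    | xy in [set xy : dual E * dual E | xy.1 != 0 /\ xy.2 != 0]].

Definition invariant_measure (T : E -> E) :=
  forall A : set (borel E), measurable A -> mu (T @^-1` A) = mu A.

Definition mixing (T : E -> E) :=
  forall A B : set (borel E), measurable A -> measurable B ->
    mu (A `&` (iter n T @^-1` B)) @[n --> \oo] --> (mu A * mu B)%E.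

End codifference.

Section tempered_stable.
Context (R : realType).
Variables (alpha a_m a_p l_m l_p : R).

Definition kappa (x : R) : R := if `|x| < 1 then 1 else `|x|^-1.

(* Lebesgue density of the Levy measure $\lambda$ *)
Definition ts_density (x : R) : R :=
  if x < 0 then a_m * expR (- l_m * `|x|) / `|x| `^ (1 + alpha)
  else if 0 < x then a_p * expR (- l_p * x) / x `^ (1 + alpha)
  else 0.

Definition ts_exponent (t : R) : R[i] :=
  cintegral (@lebesgue_measure R) (fun x : R =>
    (cexp ('i * (t * x)%:C) - 1 - 'i * (kappa x * t * x)%:C) *
    (ts_density x)%:C).

Definition tempered_stable (nu : probability (measurableTypeR R) R) :=
  forall t : R,
    cintegral nu (fun x : R => cexp ('i * (t * x)%:C)) = cexp (ts_exponent t).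

End tempered_stable.

Section random_series.
Context d (Omega : measurableType d) (R : realType) (P : probability Omega R).

Definition mutually_independent (I : choiceType) (X : I -> {RV P >-> R}) :=
  forall (s : seq I) (B : I -> set R), uniq s ->
    (forall i, measurable (B i)) ->
    P (\bigcap_(i in [set` s]) (X i @^-1` B i)) =
    (\prod_(i <- s) P (X i @^-1` B i))%E.

Definition same_law (nu : probability (measurableTypeR R) R) (X : {RV P >-> R}) :=
  forall A : set R, measurable A -> distribution P X A = nu A.

End random_series.

Definition backward_weights (R : realType) (k0 : R) (w : nat -> R) (n : nat) : R :=
  k0 * \prod_(l < n) (w l)^-1.

(* [X] is almost surely the sum in $\ell^p$ of the random series
   $\sum_n k_n (\theta_{1,n} + i \theta_{2,n}) e_n$. *)
Definition is_series_sum d (Omega : measurableType d) (R : realType)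
    (P : probability Omega R) (p : R) (p1 : 1 <= p) (k : nat -> R)
    (th1 th2 : nat -> {RV P >-> R}) (X : {RV P >-> borel (lp p1)}) :=
  {ae P, forall o,
    (\sum_(n < N) ((k n)%:C * (th1 n o +i* th2 n o)) *: lp_basis p1 n)
      @[N --> \oo] --> (X o : lp p1)}.

(* Main.v *)
Require Import Defs.
From HB Require Import structures.
From mathcomp Require Import all_boot all_order all_algebra.
From mathcomp Require Import all_classical all_reals all_analysis.
From mathcomp Require Import measurable_realfun complex ring lra.

Set Implicit Arguments.
Unset Strict Implicit.
Unset Printing Implicit Defensive.

Import Order.TTheory GRing.Theory Num.Theory.
Import numFieldNormedType.Exports.

Local Open Scope classical_set_scope.
Local Open Scope complex_scope.
Local Open Scope ring_scope.

(** The coordinates of the random series are independent, the [n]-th pair being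
    distributed as [k n] times two copies of the tempered stable variable, and
    [iter n T] multiplies the coordinate of index [m + n] by [k m / k (m + n)]
    and moves it to the place [m].  The weights are chosen so that this is
    again [k m] times a tempered stable variable: in law, [T] is the shift of
    an independent identically distributed sequence.  All three assertions
    come from this description.

    The Borel sets of [lp] are generated by the real coordinates, because [lp]
    is separable ([lp_measurable_fun]).  Hence a law on [lp] is determined by
    its values on cylinders, which gives the invariance
    ([iter_shift_invariant]).  The preimage of a Borel set by [iter n T] depends
    only on the coordinates of index at least [n], so it is independent of every
    cylinder on the first [n] coordinates; a pi-lambda argument extends the
    limit from cylinders to all Borel sets ([renyi_mixing_pi_system],
    [shift_mixing]).

    The series converges because a tempered stable variable has a second moment
    ([nu_second_moment]): the real part of its exponent is of second order at
    [0] and the imaginary part of first order, so that [1 - Re phi t] is at most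
    a multiple of [t ^ 2].  Since [k] is summable, the series then converges
    absolutely almost surely, first in l1 and therefore in [lp].

    For the codifferences, independence and dominated convergence show that the
    characteristic functional at [x] is the exponential of the sum, over the
    real coordinates, of the exponent [psi] taken at [k n] times the coefficient
    of [x] ([charfunctionalE]).  This sum is Lipschitz in [x], and a continuous
    logarithm vanishing at [0] is unique ([clogE]), so it is the logarithm that
    enters the codifferences.  In [psi (s - t) - psi s - psi (- t)] the linear
    compensator cancels and the integral of
    [(exp (i s x) - 1) (exp (- i t x) - 1)] against the Levy measure remains.
    As [|exp (i u) - 1| = 2 |sin (u / 2)|] is at most
    [2 |u / 2| ^ (p / 2)], it is bounded by [2 ^ (2 - p)] times
    [|s| ^ (p / 2) |t| ^ (p / 2)] times the moment of order [p] of the Levy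
    measure, a Gamma integral ([levy_momentE]).  Summing over the coordinates,
    with [k m] times the [m]-th coefficient of [iter n T^* y] equal to
    [k (m - n)] times the coefficient of [y] of index [m - n], gives the series
    of the statement. *)

(** * Norms with values in the reals, and the space lp *)

Section rnorm_facts.
Context {R : realType}.

Lemma gt0_complexE (e : R[i]) : 0 < e -> e = (complex.Re e)%:C /\ 0 < complex.Re e.
Proof. by case: e => a b; rewrite ltcE /= => /andP[/eqP h a0]; subst b; split. Qed.

Lemma rnorm_ltC (V : normedModType R[i]) (x : V) (e : R) :
  (`|x| < e%:C) = (rnorm x < e).
Proof. by rewrite -rnormE ltcR. Qed.

Lemma cvg_rnormP (V : normedModType R[i]) {T} {F : set_system T} {FF : Filter F}
    (u : T -> V) (l : V) :
  u @ F --> l <-> forall e : R, 0 < e -> \forall t \near F, rnorm (l - u t) < e.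
Proof.
split.
  move=> /cvgrPdist_lt h e e0.
  have := h e%:C; rewrite ltcR => /(_ e0).
  by apply: filterS => t; rewrite rnorm_ltC.
move=> h; apply/cvgrPdist_lt => e /gt0_complexE[-> e0].
by have := h _ e0; apply: filterS => t; rewrite rnorm_ltC.
Qed.

Lemma nbhs_rnormP (V : normedModType R[i]) (z : V) (A : set V) :
  nbhs z A <-> exists2 d : R, 0 < d & forall y, rnorm (z - y) < d -> A y.
Proof.
split.
  move/nbhs_normP => [d /gt0_complexE[-> d0] dA].
  by exists (complex.Re d) => // y zy; apply: dA; rewrite /= rnorm_ltC.
move=> [d d0 dA]; apply/nbhs_normP; exists d%:C; first by rewrite /= ltcR.
by move=> y; rewrite /= rnorm_ltC; exact: dA.
Qed.

Lemma lipschitz_rnorm_continuous (V W : normedModType R[i]) (f : V -> W) (C : R) :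
  (forall x y, rnorm (f x - f y) <= C * rnorm (x - y)) -> continuous f.
Proof.
move=> fC x; apply/cvg_rnormP => e e0; apply/nbhs_rnormP.
have C0 : 0 < Num.max C 1 by rewrite lt_max ltr01 orbT.
exists (e / Num.max C 1); first by rewrite divr_gt0.
move=> y; rewrite ltr_pdivlMr// mulrC; apply: le_lt_trans.
by apply: le_trans (fC x y) _; rewrite ler_wpM2r ?rnorm_ge0// le_max lexx.
Qed.

Lemma lipschitz_rnorm_continuousR (V : normedModType R[i]) (f : V -> R) (C : R) :
  (forall x y, `|f x - f y| <= C * rnorm (x - y)) -> continuous f.
Proof.
move=> fC x; apply/cvgrPdist_lt => e e0; apply/nbhs_rnormP.
have C0 : 0 < Num.max C 1 by rewrite lt_max ltr01 orbT.
exists (e / Num.max C 1); first by rewrite divr_gt0.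
move=> y; rewrite ltr_pdivlMr// mulrC; apply: le_lt_trans.
by apply: le_trans (fC x y) _; rewrite ler_wpM2r ?rnorm_ge0// le_max lexx.
Qed.

Lemma continuous_cvg_seq (V W : normedModType R[i]) (f : V -> W) (u : nat -> V) (l : V) :
  continuous f -> u @ \oo --> l -> f (u n) @[n --> \oo] --> f l.
Proof. by move=> cf ul; apply: continuous_cvg => //; exact: cf. Qed.

Lemma rnormN (V : normedModType R[i]) (x : V) : rnorm (- x) = rnorm x.
Proof. by rewrite /rnorm normrN. Qed.

Lemma rnormB (V : normedModType R[i]) (x y : V) : rnorm (x - y) = rnorm (y - x).
Proof. by rewrite /rnorm distrC. Qed.

Lemma rnorm_sum (V : normedModType R[i]) I (s : seq I) (P : pred I) (f : I -> V) :
  rnorm (\sum_(i <- s | P i) f i) <= \sum_(i <- s | P i) rnorm (f i).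
Proof.
elim/big_rec2: _ => [|i y1 y2 _ h]; first by rewrite rnorm0.
by rewrite (le_trans (rnormD _ _))// lerD2l.
Qed.

Lemma rnormCE (z : R[i]) :
  rnorm (z : R[i]^o) = Num.sqrt (complex.Re z ^+ 2 + complex.Im z ^+ 2).
Proof. by case: z. Qed.

Lemma rnorm_real (x : R) : rnorm (x%:C : R[i]^o) = `|x|.
Proof. by rewrite rnormCE /= expr0n addr0 sqrtr_sqr. Qed.

Lemma Re_le_rnorm (z : R[i]) : `|complex.Re z| <= rnorm (z : R[i]^o).
Proof.
by rewrite rnormCE -[leLHS]sqrtr_sqr ler_wsqrtr// lerDl sqr_ge0.
Qed.

Lemma Im_le_rnorm (z : R[i]) : `|complex.Im z| <= rnorm (z : R[i]^o).
Proof.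
by rewrite rnormCE -[leLHS]sqrtr_sqr ler_wsqrtr// lerDr sqr_ge0.
Qed.

Lemma rnorm_le_ReIm (z : R[i]) :
  rnorm (z : R[i]^o) <= `|complex.Re z| + `|complex.Im z|.
Proof.
rewrite rnormCE -[leRHS]ger0_norm ?addr_ge0// -sqrtr_sqr ler_wsqrtr//.
by rewrite sqrrD !real_normK ?num_real// addrAC lerDl mulrn_wge0// mulr_ge0.
Qed.

End rnorm_facts.

Section series_facts.
Context {R : realType}.
Local Open Scope ereal_scope.

Lemma nneseries_tail_small (a : nat -> R) (e : R) : (forall n, 0 <= a n)%R ->
  \sum_(n <oo) (a n)%:E < +oo -> (0 < e)%R ->
  \forall N \near \oo, \sum_(N <= n <oo) (a n)%:E < e%:E.
Proof.
move=> a0 aoo e0.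
have h := nneseries_tail_cvg aoo (fun k _ => a0 k : 0 <= (a k)%:E).
have /fine_cvgP[h1 /cvgrPdist_lt/(_ e e0) h2] := h.
apply: filterS2 h1 h2 => N N1; rewrite sub0r normrN /= => /ltr_normlW.
by rewrite -{2}(fineK N1) lte_fin.
Qed.

Lemma nneseries_term_le (a : nat -> \bar R) n : (forall n, 0 <= a n) ->
  a n <= \sum_(k <oo) a k.
Proof.
move=> a0; apply: le_trans (nneseries_lim_ge n.+1 (fun k _ _ => a0 k)).
by rewrite big_nat_recr//= leeDr// sume_ge0.
Qed.

(** Each term is at most the sum [S], hence [a n `^ q] is at most
    [S `^ (q - 1) * a n]. *)
Lemma summable_powR (a : nat -> R) (q : R) : (1 <= q)%R -> (forall n, 0 <= a n)%R ->
  \sum_(n <oo) (a n)%:E < +oo -> \sum_(n <oo) (a n `^ q)%:E < +oo.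
Proof.
move=> q1 a0 aoo.
set A := \sum_(n <oo) (a n)%:E in aoo.
have A0 : 0 <= A by apply: nneseries_ge0 => n _ _; rewrite lee_fin.
have Af : A \is a fin_num by rewrite ge0_fin_numE.
apply: (@le_lt_trans _ _ (\sum_(n <oo) ((fine A `^ (q - 1))%:E * (a n)%:E))).
  apply: lee_nneseries => n // _.
    by rewrite lee_fin powR_ge0.
  rewrite -EFinM lee_fin.
  have anA : (a n <= fine A)%R.
    rewrite -lee_fin fineK// /A.
    by apply: (@nneseries_term_le (EFin \o a)) => k; rewrite lee_fin.
  have [an0|an0] := eqVneq (a n) 0%R.
    by rewrite an0 mulr0 powR0// gt_eqF// (lt_le_trans _ q1).
  have -> : (a n `^ q = a n `^ (q - 1) * a n)%R.
    rewrite -{3}(powRr1 (a0 n)) -powRD ?subrK//.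
    by apply/implyP.
  by rewrite ler_wpM2r// ge0_ler_powR ?subr_ge0 ?nnegrE// fine_ge0.
rewrite nneseriesZl//; last by move=> n _; rewrite lee_fin.
by rewrite lte_mul_pinfty// lee_fin powR_ge0.
Qed.

End series_facts.

Section lp_theory.
Context {R : realType} {p : R} {p1 : 1 <= p}.
Notation E := (lp p1).
Implicit Types (z : E).

Let p_gt0 : 0 < p. Proof. exact: lt_le_trans p1. Qed.

Lemma in_lpP (u : nat -> R[i]^o) :
  u \in in_lp p <-> (\sum_(n <oo) ((rnorm (u n)) `^ p)%:E < +oo)%E.
Proof.
rewrite inE/= /finite_norm Lnorm_counting//.
under eq_eseriesr do rewrite /= ger0_norm ?rnorm_ge0//.
set S := (\sum_(_ <= n <oo) _)%E.
have S0 : (0 <= S)%E by apply: nneseries_ge0 => n _ _; rewrite lee_fin powR_ge0.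
split; last exact: poweR_lty.
case: S S0 => [r| |]//= _; first by move=> _; rewrite ltry.
by rewrite invr_eq0 gt_eqF.
Qed.

Lemma lp_rnorm_powR z :
  ((rnorm z `^ p)%:E = \sum_(n <oo) ((rnorm (z n)) `^ p)%:E)%E.
Proof.
have /in_lpP zoo := lp_seqP z.
have -> : rnorm z = lp_norm z by [].
rewrite /lp_norm Lnorm_counting//.
under eq_eseriesr do rewrite /= ger0_norm ?rnorm_ge0//.
have S0 : (0 <= \sum_(n <oo) ((rnorm (z n)) `^ p)%:E)%E.
  by apply: nneseries_ge0 => n _ _; rewrite lee_fin powR_ge0.
case: (\sum_(_ <= n <oo) _)%E S0 zoo => [r| |]//=; rewrite lee_fin => r0 _.
by rewrite -powRrM mulVf ?gt_eqF// powRr1.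
Qed.

Lemma lp_rnormE z :
  rnorm z = fine (\sum_(n <oo) ((rnorm (z n)) `^ p)%:E)%E `^ p^-1.
Proof.
by rewrite -lp_rnorm_powR /= -powRrM mulfV ?gt_eqF// powRr1// rnorm_ge0.
Qed.

Lemma lp_coord_le z n : rnorm (z n) <= rnorm z.
Proof.
rewrite leNgt; apply/negP => h.
have : (rnorm z) `^ p < (rnorm (z n)) `^ p.
  by rewrite gt0_ltr_powR// ?nnegrE ?rnorm_ge0.
rewrite ltNge -lee_fin lp_rnorm_powR.
rewrite (@nneseries_term_le _ (fun n => (rnorm (z n) `^ p)%:E))// => k.
by rewrite lee_fin powR_ge0.
Qed.

Lemma lpDE z1 z2 n : (z1 + z2) n = z1 n + z2 n. Proof. by []. Qed.
Lemma lpNE z n : (- z) n = - z n. Proof. by []. Qed.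
Lemma lpZE (a : R[i]) z n : (a *: z) n = a *: z n. Proof. by []. Qed.
Lemma lp0E n : (0 : E) n = 0. Proof. by []. Qed.
Lemma lp_sumE I (s : seq I) (F : I -> E) n :
  (\sum_(i <- s) F i) n = \sum_(i <- s) F i n.
Proof. by elim/big_rec2: _ => [//|i y1 y2 _ <-]; rewrite lpDE. Qed.

Lemma lp_eqP z1 z2 : (forall n, z1 n = z2 n) -> z1 = z2.
Proof. by move=> h; apply: val_inj; apply/funext. Qed.

Definition lp_trunc (u : nat -> R[i]) N : E :=
  \sum_(n < N) u n *: lp_basis p1 n.

Lemma lp_basisE n m : lp_basis p1 n m = (m == n)%:R. Proof. by []. Qed.

Lemma lp_truncE u N m : lp_trunc u N m = if (m < N)%N then u m else 0.
Proof.
rewrite /lp_trunc lp_sumE.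
under eq_bigr do rewrite lpZE lp_basisE.
case: ltnP => mN.
  rewrite (bigD1 (Ordinal mN))//= eqxx big1 ?addr0; last first.
    move=> i /eqP im; case: eqVneq => // mi; last by rewrite scaler0.
    by exfalso; apply: im; apply: val_inj.
  by rewrite /GRing.scale/= mulr1.
rewrite big1// => i _; case: eqVneq => // mi; last by rewrite scaler0.
by have := ltn_ord i; rewrite -mi ltnNge mN.
Qed.

Lemma rnorm_lp_basis n : rnorm (lp_basis p1 n) = 1.
Proof.
have : (rnorm (lp_basis p1 n) `^ p)%:E = 1%E.
  rewrite lp_rnorm_powR (@nneseriesD1 _ _ n)//; last by move=> k _; rewrite lee_fin powR_ge0.
  rewrite lp_basisE eqxx eseries0 ?adde0.
    by rewrite (rnorm_real 1) normr1 powR1.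
  move=> k _; rewrite andTb lp_basisE => kn; rewrite (negbTE kn).
  by rewrite (rnorm_real 0) normr0 powR0 ?gt_eqF.
move=> [] h.
have := congr1 (fun x : R => x `^ p^-1) h.
by rewrite -powRrM mulfV ?gt_eqF// powRr1 ?rnorm_ge0// powR1.
Qed.

(** The [p]-th power of the error is a tail of the series of the [p]-th powers
    of the coordinates.  Facts about [lp] are checked on truncations and extended
    by continuity. *)
Lemma lp_trunc_cvg z : lp_trunc z N @[N --> \oo] --> z.
Proof.
apply/cvg_rnormP => e e0.
have /in_lpP zoo := lp_seqP z.
have ep : 0 < e `^ p by rewrite powR_gt0.
have := nneseries_tail_small (fun n => powR_ge0 (rnorm (z n)) p) zoo ep.
apply: filterS => N tailN.
rewrite ltNge; apply/negP => /(ge0_ler_powR (ltW p_gt0)).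
rewrite !nnegrE (ltW e0) rnorm_ge0 => /(_ isT isT).
rewrite leNgt => /negP; apply.
rewrite -lte_fin; apply: le_lt_trans tailN.
rewrite lp_rnorm_powR (nneseries_split 0 N); last by move=> k _; rewrite lee_fin powR_ge0.
rewrite [X in (X + _)%E]big_nat_cond big1 ?add0e ?add0n; last first.
  move=> i /andP[/andP[_ iN] _]; rewrite lpDE lpNE lp_truncE iN subrr.
  by rewrite rnorm0 powR0// gt_eqF.
apply: lee_nneseries => k; first by move=> _ _; rewrite lee_fin powR_ge0.
move=> Nk; rewrite lpDE lpNE lp_truncE ltnNge.
case: leqP Nk => //= Nk; first by rewrite subr0.
by rewrite subrr rnorm0 powR0 ?gt_eqF// lee_fin powR_ge0.
Qed.

Lemma lp_coord_continuous n : continuous (fun z : E => z n : R[i]^o).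
Proof.
apply: (@lipschitz_rnorm_continuous _ E R[i]^o _ 1) => x y.
by rewrite mul1r; exact: (lp_coord_le (x - y)).
Qed.

End lp_theory.

(** * The Borel sets of lp are generated by the coordinates *)

Section lp_borel.
Context {R : realType} {p : R} {p1 : 1 <= p}.
Notation E := (lp p1).

Let p_gt0 : 0 < p. Proof. exact: lt_le_trans p1. Qed.

Let rat_vec (s : seq (rat * rat)) : E :=
  lp_trunc (fun n => let ab := nth (0, 0) s n in ratr ab.1 +i* ratr ab.2) (size s).

Let rat_vec_dense (z : E) (e : R) : 0 < e -> exists s, rnorm (z - rat_vec s) < e.
Proof.
move=> e0; have e20 : 0 < e / 2 by rewrite divr_gt0.
have /cvg_rnormP/(_ _ e20)[N _ /(_ N (leqnn N)) zN] := @lp_trunc_cvg _ _ _ z.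
(* Each of the [N] coordinates contributes at most [2 del] to the error. *)
pose del : R := e / 4 / N.+1%:R.
have del0 : 0 < del by rewrite !divr_gt0.
have approx (x : R) : exists q : rat, `|x - ratr q| < del.
  have /rat_in_itvoo[q] : x < x + del by rewrite ltrDl.
  rewrite in_itv/= => /andP[xq qx]; exists q.
  by rewrite distrC gtr0_norm ?subr_gt0// ltrBlDl.
have [a ha] := choice approx.
pose s := mkseq (fun n => (a (complex.Re (z n)), a (complex.Im (z n)))) N.
exists s.
have -> : z - rat_vec s = (z - lp_trunc z N) + (lp_trunc z N - rat_vec s).
  by rewrite addrA subrK.
rewrite (le_lt_trans (rnormD _ _))// [ltRHS](splitr e) ltrD//.
rewrite /rat_vec /lp_trunc size_mkseq -sumrB.
apply: (le_lt_trans (rnorm_sum _ _ _)).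
apply: (@le_lt_trans _ _ (\sum_(i < N) (del + del))).
  apply: ler_sum => i _; rewrite -scalerBl rnormZ rnorm_lp_basis mulr1.
  apply: (le_trans (rnorm_le_ReIm _)); rewrite nth_mkseq//.
  have := ha (complex.Re (z i)); have := ha (complex.Im (z i)).
  by case: (z i) => u v /= h1 h2; rewrite lerD// ltW.
rewrite sumr_const card_ord -mulr2n -mulrnA.
have N0 : N.+1%:R != 0 :> R by rewrite pnatr_eq0.
have -> : del *+ (2 * N) = e / 2 * (N%:R / N.+1%:R).
  rewrite /del -[LHS]mulr_natr natrM; move: (N.+1%:R : R) N0 => M N0.
  by field.
by rewrite gtr_pMr// ltr_pdivrMr// mul1r ltr_nat.
Qed.

(** The finitely supported sequences with rational entries are dense, so every
    open set is a countable union of balls centred at them; and the distance to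
    a fixed vector is a measurable function of the coordinates. *)
Lemma lp_measurable_fun d (Om : measurableType d) (X : Om -> borel E) :
  (forall n, measurable_fun setT (fun o => complex.Re ((X o : E) n))) ->
  (forall n, measurable_fun setT (fun o => complex.Im ((X o : E) n))) ->
  measurable_fun setT X.
Proof.
move=> mRe mIm.
have mdist (q : E) : measurable_fun setT (fun o => rnorm ((X o : E) - q)).
  have -> : (fun o => rnorm ((X o : E) - q)) = (fun o =>
    (fine (\sum_(n <oo) (rnorm (((X o : E) - q) n) `^ p)%:E)%E) `^ p^-1).
    by apply/funext => o; rewrite lp_rnormE.
  apply: (measurableT_comp (f := fun x : R => x `^ p^-1)).
    exact: measurable_powR.
  apply: (measurableT_comp (f := fine)); first exact: fine_measurable.
  apply: (ge0_emeasurable_sum (P := xpredT)) => [k o _ _|k _].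
    by rewrite lee_fin powR_ge0.
  apply/measurable_EFinP.
  apply: (measurableT_comp (f := fun x : R => x `^ p)).
    exact: measurable_powR.
  have -> : (fun o => rnorm (((X o : E) - q) k)) = (fun o =>
      Num.sqrt ((complex.Re ((X o : E) k) - complex.Re (q k)) ^+ 2 +
      (complex.Im ((X o : E) k) - complex.Im (q k)) ^+ 2)).
    apply/funext => o; rewrite rnormCE lpDE lpNE.
    by case: ((X o : E) k) => ? ?; case: (q k).
  apply: (measurableT_comp (f := fun x : R => Num.sqrt x)).
    by apply: continuous_measurable_fun; exact: sqrt_continuous.
  apply: measurable_funD; apply: measurable_funX; apply: measurable_funB => //.
have := @measurability _ _ Om (borel E) setT X (@open E) erefl.
apply => _ [U oU <-].
pose B (j : seq (rat * rat) * nat) : set Om :=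
  if `[< [set y | rnorm (rat_vec j.1 - y) < j.2.+1%:R^-1] `<=` U >]
  then [set o | rnorm ((X o : E) - rat_vec j.1) < j.2.+1%:R^-1] else set0.
have -> : setT `&` X @^-1` U = \bigcup_j B j.
  rewrite setTI; apply/seteqP; split => [ o UXo|o [j _]]; last first.
    by rewrite /B; case: asboolP => // BU /= oB; apply: BU; rewrite /= rnormB.
  have /nbhs_rnormP[e e0 eU] : nbhs (X o : E) U by exact: open_nbhs_nbhs.
  have [m me] : exists m, m.+1%:R^-1 < e / 2.
    have e20 : 0 < e / 2 by rewrite divr_gt0.
    have [m _ /(_ m (leqnn m)) h] := near_infty_natSinv_lt (PosNum e20).
    by exists m.
  have m0 : (0 : R) < m.+1%:R^-1 by rewrite invr_gt0.
  have [s sX] := rat_vec_dense (X o) m0.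
  exists (s, m) => //; rewrite /B; case: asboolP => //=.
  move=> []; move=> y /= sy; apply: eU.
  have -> : (X o : E) - y = (X o - rat_vec s) + (rat_vec s - y).
    by rewrite addrA subrK.
  rewrite (le_lt_trans (rnormD _ _))// (splitr e) ltrD//; exact: lt_trans me.
apply: countable_bigcupT_measurable; first exact: countableP.
move=> j; rewrite /B; case: ifP => // _.
by rewrite -[X in measurable X]setTI; apply: measurable_fun_ltr.
Qed.

Lemma measurable_lp_coord n : measurable_fun setT (fun z : borel E => complex.Re ((z : E) n)) /\
  measurable_fun setT (fun z : borel E => complex.Im ((z : E) n)).
Proof.
have cont_borel (f : E -> R) : continuous f -> measurable_fun setT (f : borel E -> R).
  move=> cf.
  apply: (measurability _ (@RGenOInfty.measurableE R)) => _ [_ [x ->] <-]; rewrite setTI; apply: sub_sigma_algebra.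
  by apply: open_comp => [y _|]; [exact: cf|exact: interval_open].
split; apply: cont_borel; apply: (@lipschitz_rnorm_continuousR _ E _ 1) => x y;
  rewrite mul1r; apply: le_trans (lp_coord_le (x - y) n); rewrite lpDE lpNE.
- by apply: le_trans (Re_le_rnorm _); case: (x n) (y n) => ? ? [].
- by apply: le_trans (Im_le_rnorm _); case: (x n) (y n) => ? ? [].
Qed.

End lp_borel.

(** * Independence and the pi-lambda argument *)

Section renyi_mixing.
Context d (T : measurableType d) (R : realType) (P : probability T R).
Notation pr A := (fine (P A)).

Let probE A : measurable A -> P A = (pr A)%:E.
Proof. by move=> mA; rewrite fineK// fin_num_measure. Qed.

Lemma prob_fineD A B : measurable A -> measurable B ->
  pr (~` A `&` B) = pr B - pr (A `&` B).
Proof.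
move=> mA mB; apply: EFin_inj; rewrite EFinB -!probE//; last 2 first.
- exact: measurableI.
- by apply: measurableI => //; exact: measurableC.
by rewrite setIC -setDE measureD// 1?setIC// -ge0_fin_numE// fin_num_measure.
Qed.

Lemma prob_fine_le A B : measurable A -> measurable B -> A `<=` B -> pr A <= pr B.
Proof.
move=> mA mB AB; rewrite -lee_fin -!probE//.
by apply: le_measure; rewrite ?inE.
Qed.

(** The sets [A] with this limit form a Dynkin class: in a disjoint union the
    tail has small probability, so cutting it off costs little uniformly in [n]. *)
Lemma renyi_mixing_pi_system (G : set (set T)) (C : (set T)^nat) (b : R) :
  setI_closed G -> G setT -> G `<=` measurable -> (forall n, measurable (C n)) ->
  (forall A, G A -> pr (A `&` C n) @[n --> \oo] --> pr A * b) ->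
  forall A, <<s G >> A -> pr (A `&` C n) @[n --> \oo] --> pr A * b.
Proof.
move=> GI GT Gm mC GC.
have sGm A : <<s G >> A -> measurable A.
  by apply: smallest_sub => //; exact: sigma_algebra_measurable.
have prT : pr setT = 1 by rewrite probability_setT.
apply: (@dynkin_induction _ (g_sigma_algebraType G) G
  (fun A => pr (A `&` C n) @[n --> \oo] --> pr A * b)) => //.
- exact: GC.
- move=> S mS hS; have mS' : @measurable _ T S by exact: sGm.
  have -> : (fun n => pr (~` S `&` C n)) = (fun n => pr (setT `&` C n) - pr (S `&` C n)).
    by apply/funext => n; rewrite setTI; exact: prob_fineD.
  have -> : pr (~` S) * b = pr setT * b - pr S * b.
    have := prob_fineD mS' (@measurableT _ T); rewrite !setIT => ->.
    by rewrite mulrBl.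
  by apply: cvgB => //; exact: GC.
- move=> /= F' mF' tF hF; pose F : (set T)^nat := F'.
  have mF n : measurable (F n) by apply: sGm; exact: mF'.
  pose H K := \big[setU/set0]_(k < K) F k.
  have mH K : measurable (H K) by exact: bigsetU_measurable.
  have mU : measurable (\bigcup_k F k) by exact: bigcup_measurable.
  have HU K : H K `<=` \bigcup_k F k by move=> t; rewrite /H -bigcup_mkord => -[k _ Fk]; exists k.
  have prHC (D : set T) K : measurable D -> pr (H K `&` D) = \sum_(k < K) pr (F k `&` D).
    move=> mD; rewrite /H big_distrl/=; apply: EFin_inj.
    rewrite -probE; last by apply: bigsetU_measurable => i _; exact: measurableI.
    have mFD k : measurable (F k `&` D) by exact: measurableI.
    have tFD : trivIset setT (fun k => F k `&` D).
      apply/trivIsetP => i j _ _ ij; rewrite setIACA.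
      by move/trivIsetP : tF => ->//; rewrite set0I.
    rewrite (measure_bigsetU P mFD tFD) -sumEFin; apply: eq_bigr => k _.
    by rewrite -probE.
  have prH K : pr (H K) = \sum_(k < K) pr (F k).
    by have := prHC setT K measurableT; under eq_bigr do rewrite setIT; rewrite setIT.
  have cvgH : pr (H K) @[K --> \oo] --> pr (\bigcup_k F k).
    apply: fine_cvg; rewrite -probE//.
    have HE : \bigcup_k F k = \bigcup_K H K.
      apply/seteqP; split => t [k _].
        by move=> Fk; exists k.+1 => //; rewrite /H -bigcup_mkord; exists k => /=.
      by move=> /HU.
    rewrite HE; apply: nondecreasing_cvg_mu => //; first by rewrite -HE.
    by move=> m n mn; apply/subsetPset; exact: subset_bigsetU.
  have cvgHb : pr (H K) * b @[K --> \oo] --> pr (\bigcup_k F k) * b.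
    by apply: cvgM => //; exact: cvg_cst.
  suff : pr (\bigcup_k F k `&` C n) @[n --> \oo] --> pr (\bigcup_k F k) * b by [].
  apply/cvgrPdist_lt => e e0.
  have e40 : 0 < e / 4 by rewrite divr_gt0.
  have /cvgrPdist_lt/(_ _ e40)[K1 _ hK1] := cvgH.
  have /cvgrPdist_lt/(_ _ e40)[K2 _ hK2] := cvgHb.
  pose K := maxn K1 K2.
  have {}hK1 : `|pr (\bigcup_k F k) - pr (H K)| < e / 4.
    by apply: hK1; exact: leq_maxl.
  have {}hK2 : `|pr (\bigcup_k F k) * b - pr (H K) * b| < e / 4.
    by apply: hK2; exact: leq_maxr.
  have : pr (H K `&` C n) @[n --> \oo] --> pr (H K) * b.
    rewrite prH big_distrl/=.
    have -> : (fun n => pr (H K `&` C n)) = (fun n => \sum_(k < K) pr (F k `&` C n)).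
      by apply/funext => n; exact: prHC.
    by apply: cvg_big => [|i _]; [exact: add_continuous|exact: hF].
  move=> /cvgrPdist_lt/(_ _ e40); apply: filterS => n hn.
  have mHC : measurable (H K `&` C n) by exact: measurableI.
  have mUC : measurable (\bigcup_k F k `&` C n) by exact: measurableI.
  have mUnH : measurable (~` H K `&` \bigcup_k F k).
    by apply: measurableI => //; exact: measurableC.
  have h1 : pr (H K `&` C n) <= pr (\bigcup_k F k `&` C n).
    by apply: prob_fine_le => //; exact: setSI.
  have h2 : pr (\bigcup_k F k `&` C n) - pr (H K `&` C n) <=
            pr (\bigcup_k F k) - pr (H K).
    have := prob_fineD (mH K) mU; rewrite (setIidl (@HU K)) => <-.
    have := prob_fineD (mH K) mUC.
    have -> : H K `&` (\bigcup_k F k `&` C n) = H K `&` C n.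
      by rewrite setIA (setIidl (@HU K)).
    move=> <-; apply: prob_fine_le => //.
      by apply: measurableI => //; exact: measurableC.
    by rewrite setIA; exact: subIsetl.
  move: hK1 hK2 hn; rewrite !ltr_norml => /andP[_ a2] /andP[b1 b2] /andP[c1 c2].
  apply/andP; split; lra.
Qed.

Lemma indep_pi_system (G : set (set T)) (B : set T) :
  setI_closed G -> G setT -> G `<=` measurable -> measurable B ->
  (forall A, G A -> P (A `&` B) = (P A * P B)%E) ->
  forall A, <<s G >> A -> P (A `&` B) = (P A * P B)%E.
Proof.
move=> GI GT Gm mB GB A sA.
have mA : measurable A.
  by move: A sA; apply: smallest_sub => //; exact: sigma_algebra_measurable.
rewrite (probE mA) (probE mB) (probE (measurableI _ _ mA mB)) -EFinM; congr EFin.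
have h : pr (A `&` B) @[n --> \oo] --> pr A * pr B.
  apply: (@renyi_mixing_pi_system G (fun=> B)) => // {sA mA}A GA.
  rewrite GB// fineM ?fin_num_measure//; [exact: cvg_cst|exact: Gm].
have := cvg_lim _ h => <- //.
by rewrite lim_cst.
Qed.

End renyi_mixing.

Section independent_coordinates.
Context d (T : measurableType d) (R : realType) (P : probability T R).
Context (I : choiceType) (c : I -> T -> R).

(** Repetitions are allowed in the list of indices, so that the intersection of
    two cylinders is indexed by the concatenation of their lists. *)
Definition cylinders (J : set I) : set (set T) :=
  [set A | exists (s : seq I) (B : I -> set R), [/\ [set` s] `<=` J,
    forall i, measurable (B i) & A = \bigcap_(i in [set` s]) c i @^-1` B i]].

Lemma cylinders_setT J : cylinders J setT.
Proof. by exists [::], (fun=> setT); split => //; apply/esym/seteqP; split. Qed.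

Lemma cylinders_setI J : setI_closed (cylinders J).
Proof.
move=> _ _ [s1 [B1 [sJ1 mB1 ->]]] [s2 [B2 [sJ2 mB2 ->]]].
exists (s1 ++ s2), (fun i => (if i \in s1 then B1 i else setT) `&`
                             (if i \in s2 then B2 i else setT)).
split.
- by move=> i /=; rewrite mem_cat => /orP[/sJ1|/sJ2].
- by move=> i; apply: measurableI; case: ifP.
apply/seteqP; split => [t [h1 h2] i /=|t h].
  move=> _; split; case: ifPn => // is_; [exact: (h1 i)|exact: (h2 i)].
split => i /= is_.
  by have := h i; rewrite /= mem_cat is_ => /(_ isT)[].
by have := h i; rewrite /= mem_cat is_ orbT => /(_ isT)[].
Qed.

(** With the sigma-algebra generated by the cylinders over [J] as a measurable
    structure of its own, being determined by the coordinates in [J] becomes a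
    measurability property, and composes as such. *)
Lemma measurable_coord_cylinders (J : set I) i : J i ->
  measurable_fun setT (c i : g_sigma_algebraType (cylinders J) -> R).
Proof.
move=> Ji _ B mB; rewrite setTI; apply: sub_sigma_algebra.
exists [:: i], (fun=> B); split => //.
  by move=> j /=; rewrite inE => /eqP ->.
apply/seteqP; split => [t cB j /=|t]; first by rewrite inE => /eqP ->.
by apply; rewrite /= inE.
Qed.

Hypothesis mc : forall i, measurable_fun setT (c i).

Lemma measurable_cylinders J : cylinders J `<=` measurable.
Proof.
move=> _ [s [B [_ mB ->]]]; apply: fin_bigcap_measurable => // i _.
by rewrite -[X in measurable X]setTI; exact: mc.
Qed.

Lemma measurable_sigma_cylinders J : <<s cylinders J >> `<=` measurable.
Proof.
apply: smallest_sub; first exact: sigma_algebra_measurable.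
exact: measurable_cylinders.
Qed.

Hypothesis indep : forall (s : seq I) (B : I -> set R), uniq s ->
  (forall i, measurable (B i)) ->
  P (\bigcap_(i in [set` s]) (c i @^-1` B i)) = (\prod_(i <- s) P (c i @^-1` B i))%E.

Let cylinders_indep J1 J2 A B : J1 `&` J2 = set0 ->
  cylinders J1 A -> cylinders J2 B -> P (A `&` B) = (P A * P B)%E.
Proof.
move=> J12 [s1 [B1 [sJ1 mB1 ->]]] [s2 [B2 [sJ2 mB2 ->]]].
have us (s : seq I) : [set` s] = [set` undup s].
  by apply/seteqP; split => i /=; rewrite mem_undup.
rewrite (us s1) (us s2) in sJ1 sJ2 *.
move: (undup_uniq s1) (undup_uniq s2) sJ1 sJ2.
move: (undup s1) (undup s2) => {us}{}s1 {}s2 u1 u2 sJ1 sJ2.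
pose B0 i := if i \in s1 then B1 i else B2 i.
have s12 i : i \in s2 -> i \in s1 = false.
  move=> i2; apply/negP => i1; have : (J1 `&` J2) i by split; [exact: sJ1|exact: sJ2].
  by rewrite J12.
have u12 : uniq (s1 ++ s2).
  rewrite cat_uniq u1 u2 andbT/=; apply/hasPn => i i2.
  by rewrite /= s12.
have mB0 i : measurable (B0 i) by rewrite /B0; case: ifP.
have := indep u12 mB0; rewrite big_cat/=.
rewrite (eq_big_seq (fun i => P (c i @^-1` B1 i))); last by move=> i is1; rewrite /B0 is1.
rewrite -indep// [X in (_ * X)%E](eq_big_seq (fun i => P (c i @^-1` B2 i))); last first.
  by move=> i is2; rewrite /B0 s12.
rewrite -indep// => <-.
congr (P _); apply/seteqP; split => [t [h1 h2] i /=|t h].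
  rewrite mem_cat /B0 => /orP[i1|i2]; first by rewrite i1; exact: h1.
  by rewrite s12//; exact: h2.
split => i /= is_; have := h i; rewrite /= mem_cat is_ /B0.
  by rewrite is_ => /(_ isT).
by rewrite orbT s12// => /(_ isT).
Qed.

(** Independence passes from cylinders to the generated sigma-algebras in two
    steps, one side at a time. *)
Lemma sigma_cylinders_indep J1 J2 A B : J1 `&` J2 = set0 ->
  <<s cylinders J1 >> A -> <<s cylinders J2 >> B -> P (A `&` B) = (P A * P B)%E.
Proof.
move=> J12 sA sB.
have mB := measurable_sigma_cylinders sB.
move: A sA; apply: (indep_pi_system (@cylinders_setI J1)) => //.
- exact: cylinders_setT.
- exact: measurable_cylinders.
move=> A cA; have mA := measurable_cylinders cA.
rewrite setIC muleC; move: B sB {mB}; apply: (indep_pi_system (@cylinders_setI J2)) => //.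
- exact: cylinders_setT.
- exact: measurable_cylinders.
by move=> B cB; rewrite setIC muleC; exact: cylinders_indep J12 _ _.
Qed.

End independent_coordinates.

(** * The weighted shift on independent coordinates *)

Section lp_coordinates.
Context {R : realType} {p : R} {p1 : 1 <= p}.
Notation E := (lp p1).

(** The real coordinates of [lp], in the indexing of the random series:
    [(true, n)] is the real part and [(false, n)] the imaginary part. *)
Definition lpc (i : bool * nat) (z : borel E) : R :=
  if i.1 then complex.Re ((z : E) i.2) else complex.Im ((z : E) i.2).

Lemma measurable_lpc i : measurable_fun setT (lpc i).
Proof. by case: i => [[] n]; have [] := @measurable_lp_coord R p p1 n. Qed.

Lemma lp_measurable_lpc d (Om : measurableType d) (X : Om -> borel E) :
  (forall i, measurable_fun setT (fun o => lpc i (X o))) -> measurable_fun setT X.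
Proof.
move=> h; apply: lp_measurable_fun => n; first exact: (h (true, n)).
exact: (h (false, n)).
Qed.

(** The identity is measurable from the sigma-algebra of the cylinders to the
    Borel sets, since its coordinates are. *)
Lemma lp_measurable_sigma_cylinders (A : set (borel E)) :
  measurable A -> <<s cylinders lpc setT >> A.
Proof.
move=> mA.
have := @lp_measurable_lpc _ (g_sigma_algebraType (cylinders lpc setT)) id.
move=> /(_ (fun i => measurable_coord_cylinders I)).
by move=> /(_ measurableT A mA); rewrite setTI.
Qed.

End lp_coordinates.

Section weighted_shift.
Context {R : realType} {p : R} {p1 : 1 <= p}.
Notation E := (lp p1).
Context (w k : nat -> R) (k_gt0 : forall n, 0 < k n)
  (kS : forall n, k n = w n * k n.+1).
Context (T : {linear E -> E}) (T_cont : continuous T)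
  (T_e0 : T (lp_basis p1 0) = 0)
  (T_eS : forall n, T (lp_basis p1 n.+1) = (w n)%:C *: lp_basis p1 n).

Lemma shift_trunc (z : E) N : T (lp_trunc z N.+1) = \sum_(n < N) ((w n)%:C * z n.+1) *: lp_basis p1 n.
Proof.
rewrite /lp_trunc linear_sum big_ord_recl linearZ/= T_e0 scaler0 add0r.
apply: eq_bigr => n _; rewrite linearZ/= /bump add1n T_eS scalerA mulrC.
by [].
Qed.

(** Both sides are continuous in [z] and agree on truncations. *)
Lemma shift_coord (z : E) m : T z m = (w m)%:C * z m.+1.
Proof.
apply/eqP; rewrite -subr_eq0; apply/eqP; apply: rnorm_eq0; apply/eqP.
rewrite eq_le rnorm_ge0 andbT leNgt; apply/negP => e0.
set e := rnorm _ in e0.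
have Tz : T (lp_trunc z N) m @[N --> \oo] --> (T z m : R[i]^o).
  have Tcvg : T (lp_trunc z N) @[N --> \oo] --> T z.
    by apply: (@continuous_cvg_seq _ E E T) => //; exact: lp_trunc_cvg.
  apply: (@continuous_cvg_seq _ E R[i]^o (fun u => u m)) => //.
  exact: lp_coord_continuous.
have /cvg_rnormP/(_ _ e0)[N _ hN] := Tz.
have := hN (maxn N m.+1).+1 (leq_trans (leq_maxl _ _) (leqnSn _)).
have -> : T (lp_trunc z (maxn N m.+1).+1) = lp_trunc (fun n => (w n)%:C * z n.+1) (maxn N m.+1).
  by rewrite shift_trunc.
by rewrite lp_truncE leq_maxr ltxx.
Qed.

Lemma iter_shift_coord n (z : E) m :
  iter n T z m = (k m / k (m + n))%:C * z (m + n)%N.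
Proof.
have kn0 j : k j != 0 by rewrite gt_eqF.
elim: n m => [|n IH] m; first by rewrite addn0 divff// mul1r.
rewrite iterS shift_coord IH addSnnS mulrA -rmorphM/=; congr (_%:C * _).
by rewrite (kS m) mulrA.
Qed.

Lemma lpc_iter_shift n (z : borel E) i :
  lpc i (iter n T z) = (k i.2 / k (i.2 + n)) * lpc (i.1, i.2 + n)%N z.
Proof.
case: i => [[] m]; rewrite /lpc/= iter_shift_coord.
  by case: ((z : E) _) => a b /=; rewrite mul0r subr0.
by case: ((z : E) _) => a b /=; rewrite mul0r addr0.
Qed.

Variables (mu : probability (borel E) R) (nu : probability (measurableTypeR R) R).
Hypothesis mu_cyl : forall (s : seq (bool * nat)) (B : bool * nat -> set R),
  uniq s -> (forall i, measurable (B i)) ->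
  mu (\bigcap_(i in [set` s]) (lpc i @^-1` B i)) =
  (\prod_(i <- s) nu [set t | B i (k i.2 * t)%R])%E.

Lemma lpc_law i (B : set R) : measurable B ->
  mu (lpc i @^-1` B) = nu [set t | B (k i.2 * t)].
Proof.
move=> mB; have := @mu_cyl [:: i] (fun=> B) isT (fun=> mB).
rewrite big_seq1 => <-; congr (mu _); apply/seteqP; split => z; last by apply; rewrite /= inE.
by move=> Bz j; rewrite /= inE => /eqP ->.
Qed.

Lemma lpc_indep (s : seq (bool * nat)) (B : bool * nat -> set R) :
  uniq s -> (forall i, measurable (B i)) ->
  mu (\bigcap_(i in [set` s]) (lpc i @^-1` B i)) =
  (\prod_(i <- s) mu (lpc i @^-1` B i))%E.
Proof. by move=> us mB; rewrite mu_cyl//; apply: eq_bigr => i _; rewrite lpc_law. Qed.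

Lemma measurable_iter_shift n : measurable_fun setT (iter n T : borel E -> borel E).
Proof.
apply: lp_measurable_lpc => i; under eq_fun do rewrite lpc_iter_shift.
by apply: measurable_funM => //; exact: measurable_lpc.
Qed.

(** The coordinates of [iter n T z] are, up to the positive factors that
    [mu_cyl] cancels, the coordinates of [z] shifted by [n]. *)
Lemma iter_shift_invariant n (A : set (borel E)) : measurable A ->
  mu (iter n T @^-1` A) = mu A.
Proof.
move=> mA.
pose Tm : {mfun borel E >-> borel E} := HB.pack (iter n T : borel E -> borel E)
  (isMeasurableFun.Build _ _ _ _ _ (measurable_iter_shift n)).
have -> : mu (iter n T @^-1` A) = distribution mu Tm A by [].
apply: (g_sigma_algebra_measure_unique (cylinders lpc setT) _ (fun=> setT)).
- exact: (measurable_cylinders measurable_lpc).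
- by move=> _; exact: cylinders_setT.
- by apply/seteqP; split => // z _; exists 0.
- exact: cylinders_setI.
- move=> _ [s [B [_ mB ->]]].
  have -> : [set` s] = [set` undup s].
    by apply/seteqP; split => i /=; rewrite mem_undup.
  have us := undup_uniq s; move: (undup s) us => {}s us.
  transitivity (\prod_(i <- s) nu [set t | B i (k i.2 * t)%R])%E; last first.
    exact/esym/mu_cyl.
  pose sh (i : bool * nat) : bool * nat := (i.1, i.2 + n)%N.
  have sh_inj : injective sh.
    by move=> [a b] [a' b'] [-> /eqP]; rewrite eqn_add2r => /eqP ->.
  (* The preimage of the cylinder is the one with bases [B'] on the shifted
     coordinates. *)
  pose B' (i : bool * nat) : set R :=
    [set t | B (i.1, i.2 - n)%N (k (i.2 - n)%N / k i.2 * t)].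
  have shK i : ((sh i).1, (sh i).2 - n)%N = i.
    by case: i => a b; rewrite /sh/= addnK.
  have mB' i : measurable (B' i).
    rewrite -[X in measurable X]setTI.
    by apply: (measurable_funM (measurable_cst _) (@measurable_id _ _ _)).
  transitivity (mu (\bigcap_(i in [set` [seq sh i | i <- s]]) (lpc i @^-1` B' i))).
    rewrite /distribution/= /pushforward; congr (mu _).
    apply/seteqP; split => [z h _ /= /mapP[i is_ ->]|z h i /= is_].
      have := h i is_; rewrite /= /B' lpc_iter_shift /= addnK.
      by case: (i).
    have := h (sh i) (map_f _ is_).
    by rewrite /= /B' lpc_iter_shift /= addnK; case: (i).
  rewrite mu_cyl//; last by rewrite map_inj_uniq.
  rewrite big_map; apply: eq_bigr => i _; congr (nu _).
  have ks : k (i.2 + n) != 0 by rewrite gt_eqF.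
  rewrite /B' /= addnK; apply/seteqP; split => t /=; rewrite mulrA divfK//; by case: (i).
- by move=> _; apply: le_lt_trans (ltry 1); exact: (@probability_le1 _ _ _ (distribution mu Tm)).
- exact: lp_measurable_sigma_cylinders.
Qed.

Lemma shift_invariant : invariant_measure mu T.
Proof. by move=> A mA; exact: (iter_shift_invariant 1 mA). Qed.

(** A cylinder on coordinates of index less than [n] is independent of the
    preimages by [iter n T], which depend on the later coordinates only. *)
Lemma shift_mixing : mixing mu T.
Proof.
move=> A B mA mB.
pose Tn n : borel E -> borel E := iter n T.
suff : mu (A `&` Tn n @^-1` B) @[n --> \oo] --> (mu A * mu B)%E by [].
have prE C : measurable C -> mu C = (fine (mu C))%:E.
  by move=> mC; rewrite fineK// fin_num_measure.
have mTB n : measurable (Tn n @^-1` B).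
  by rewrite -[X in measurable X]setTI; exact: measurable_iter_shift.
have sub_sig n : <<s cylinders lpc [set i : bool * nat | (n <= i.2)%N] >> (Tn n @^-1` B).
  have := @lp_measurable_lpc _ _ _ _
    (g_sigma_algebraType (cylinders (@lpc R p p1) [set i | (n <= i.2)%N])) (Tn n).
  move=> h; have {h} := h _ measurableT B mB; rewrite setTI; apply => i.
  have -> : (fun o : g_sigma_algebraType (cylinders (@lpc R p p1) [set i | (n <= i.2)%N]) =>
      lpc i (Tn n o)) = (fun o => (k i.2 / k (i.2 + n)) * lpc (i.1, i.2 + n)%N o).
    by apply/funext => z; rewrite lpc_iter_shift.
  apply: measurable_funM => //; apply: measurable_coord_cylinders.
  by rewrite /= leq_addl.
have h : fine (mu (A `&` Tn n @^-1` B)) @[n --> \oo] --> fine (mu A) * fine (mu B).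
  apply: (@renyi_mixing_pi_system _ _ _ mu (cylinders lpc setT)) => //.
  - exact: cylinders_setI.
  - exact: cylinders_setT.
  - exact: (measurable_cylinders measurable_lpc).
  - move=> A0 [s [D [_ mD AE]]].
    (* From [N] on, the shift has moved past all coordinates of the cylinder. *)
    pose N := \max_(i <- s) i.2.+1.
    have cA n : (N <= n)%N -> cylinders lpc [set i : bool * nat | (i.2 < n)%N] A0.
      move=> Nn; exists s, D; split => // i is_ /=; apply: leq_trans Nn.
      exact: (@leq_bigmax_seq _ s xpredT (fun i : bool * nat => i.2.+1) i is_ isT).
    apply: cvg_near_cst; exists N => // n /= Nn.
    have mA' : measurable A0.
      by have := cA _ Nn; exact: (measurable_cylinders measurable_lpc).
    have sA0 : <<s cylinders lpc [set i : bool * nat | (i.2 < n)%N] >> A0.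
      by apply: sub_sigma_algebra; exact: cA.
    have := sigma_cylinders_indep measurable_lpc lpc_indep _ sA0 (sub_sig n).
    move=> ->; last first.
      by apply/seteqP; split => // i /= [h1 h2]; rewrite ltnNge h2 in h1.
    by rewrite iter_shift_invariant// fineM// fin_num_measure.
  - exact: lp_measurable_sigma_cylinders.
rewrite (prE A mA) (prE B mB) -EFinM.
have -> : (fun n => mu (A `&` Tn n @^-1` B)) =
    (fun n => (fine (mu (A `&` Tn n @^-1` B)))%:E).
  by apply/funext => n; rewrite -prE//; exact: measurableI.
by apply/fine_cvgP; split; [exact: nearW|exact: h].
Qed.

End weighted_shift.

(** * Trigonometric inequalities *)

Section trigonometric_bounds.
Context {R : realType}.
Implicit Types x y : R.

Let sin_MVT x : 0 <= x -> exists2 c, 0 <= c <= x & sin x = cos c * x.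
Proof.
move=> x0; have [|c] := @MVT_segment R sin cos 0 x x0 (fun y _ => is_derive_sin y).
  by apply: continuous_subspaceT => y; exact: continuous_sin.
by rewrite in_itv/= sin0 !subr0 => cx e; exists c.
Qed.

Lemma sin_abs_le x : `|sin x| <= `|x|.
Proof.
wlog x0 : x / 0 <= x => [h|].
  have [/h//|/ltW x0] := leP 0 x; rewrite -normrN -sinN -(normrN x).
  by apply: h; rewrite oppr_ge0.
have [c _ ->] := sin_MVT x0; rewrite normrM ler_piMl// ler_norml.
by rewrite cos_geN1 cos_le1.
Qed.

Let half_angle x y : x = (x + y) / 2 + (x - y) / 2 /\ y = (x + y) / 2 - (x - y) / 2.
Proof. by split; field. Qed.

Lemma cos_dist_le x y : `|cos x - cos y| <= `|x - y|.
Proof.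
set u := (x + y) / 2; set v := (x - y) / 2.
have [ex ey] : x = u + v /\ y = u - v by exact: half_angle.
rewrite [X in cos X - _]ex [X in _ - cos X]ey cosD cosB.
have -> : cos u * cos v - sin u * sin v - (cos u * cos v + sin u * sin v) =
  - (sin u * (2 * sin v)) by ring.
have -> : x - y = 2 * v by rewrite /v; field.
rewrite normrN normrM [`|2 * sin v|]normrM [leRHS]normrM -[leRHS]mul1r.
by rewrite ler_pM ?sin_max// ler_wpM2l// sin_abs_le.
Qed.

Lemma sin_dist_le x y : `|sin x - sin y| <= `|x - y|.
Proof.
set u := (x + y) / 2; set v := (x - y) / 2.
have [ex ey] : x = u + v /\ y = u - v by exact: half_angle.
rewrite [X in sin X - _]ex [X in _ - sin X]ey sinD sinB.
have -> : sin u * cos v + cos u * sin v - (sin u * cos v - cos u * sin v) =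
  cos u * (2 * sin v) by ring.
have -> : x - y = 2 * v by rewrite /v; field.
rewrite normrM [`|2 * sin v|]normrM [leRHS]normrM -[leRHS]mul1r.
by rewrite ler_pM ?cos_max// ler_wpM2l// sin_abs_le.
Qed.

Let one_sub_cosE x : 1 - cos x = 2 * sin (x / 2) ^+ 2.
Proof.
have -> : cos x = cos ((x / 2) *+ 2) by rewrite -mulr_natr divfK.
rewrite cos_mulr2n -[X in _ - (X *+ 2 - 1)]addr0 -(subrr (sin (x / 2) ^+ 2)).
by rewrite addrA cos2Dsin2; ring.
Qed.

Lemma one_sub_cos_le x : 1 - cos x <= x ^+ 2 / 2.
Proof.
rewrite one_sub_cosE.
have h : sin (x / 2) ^+ 2 <= (x / 2) ^+ 2.
  by rewrite -(real_normK (num_real (sin _))) -[leRHS](real_normK (num_real _));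
     rewrite lerXn2r ?nnegrE// sin_abs_le.
by apply: (le_trans (ler_wpM2l _ h)) => //; rewrite le_eqVlt; apply/orP; left; apply/eqP; field.
Qed.

(** On [0, 1/2] the cosine is at least [1/2], so [sin y] is at least [y / 2]
    there by the mean value theorem; this is used at [y = x / 2]. *)
Lemma one_sub_cos_ge x : `|x| <= 1 -> x ^+ 2 / 8 <= 1 - cos x.
Proof.
move=> x1; rewrite one_sub_cosE.
wlog x0 : x x1 / 0 <= x => [h|].
  have [/h->//|/ltW x0] := leP 0 x.
  by have := h (- x); rewrite normrN sqrrN mulNr sinN sqrrN; apply => //; rewrite oppr_ge0.
rewrite ger0_norm// in x1.
have x20 : 0 <= x / 2 by rewrite divr_ge0.
have [c /andP[c0 cx] ->] := sin_MVT x20.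
have cc : 1 / 2 <= cos c.
  have := one_sub_cos_le c; have : c ^+ 2 <= 1 by rewrite expr_le1//; lra.
  lra.
have : (x / 4) ^+ 2 <= (cos c * (x / 2)) ^+ 2.
  rewrite lerXn2r ?nnegrE//; [lra|by rewrite mulr_ge0//; lra|].
  have -> : x / 4 = 1 / 2 * (x / 2) by field.
  by rewrite ler_wpM2r.
have -> : x ^+ 2 / 8 = 2 * (x / 4) ^+ 2 by field.
by move=> h; rewrite ler_wpM2l.
Qed.

(** Interpolation between the bounds [|x|] and [1]. *)
Lemma sin_abs_le_powR x (q : R) : 0 <= q <= 1 -> `|sin x| <= `|x| `^ q.
Proof.
move=> /andP[q0 q1].
have [x1|x1] := leP `|x| 1.
  apply: (le_trans (sin_abs_le x)).
  have [x0|x0] := eqVneq x 0.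
    by rewrite x0 normr0 powR_ge0.
  by apply: ger1_powR => //; rewrite normr_gt0 x0.
apply: (le_trans (sin_max x)).
by rewrite -[leLHS](powRr0 `|x|) ler_powR// ltW.
Qed.

End trigonometric_bounds.

(** * Scaling of the Lebesgue measure and the Gamma integral *)

Section lebesgue_scaling.
Context {R : realType}.
Local Open Scope ereal_scope.
Notation mu := (@lebesgue_measure R).

Lemma lebesgue_measure_scale (l : R) (l0 : (0 < l)%R) (A : set R) : measurable A ->
  mu A = l%:E * pushforward mu (( *%R l) : _ -> measurableTypeR R) A.
Proof.
move=> mA.
have ml : measurable_fun setT (( *%R l) : measurableTypeR R -> measurableTypeR R).
  exact: (measurable_funM (measurable_cst _) (@measurable_id _ _ _)).
pose ml' : {mfun measurableTypeR R >-> measurableTypeR R} := HB.pack ( *%R l)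
  (isMeasurableFun.Build _ _ _ _ _ ml).
pose l' : {nonneg R} := NngNum (ltW l0).
have -> : l%:E * pushforward mu (( *%R l) : _ -> measurableTypeR R) A =
  mscale l' (pushforward mu ml') A by [].
apply: lebesgue_measure_unique => //= _ [[a b]] _ <-.
transitivity (l%:E * mu `](a / l)%R, (b / l)%R]%classic); last first.
  congr (_ * mu _); apply/seteqP.
  by split => x; rewrite /= !in_itv/= ltr_pdivrMr// ler_pdivlMr// mulrC.
rewrite !lebesgue_measure_itv/= !lte_fin ltr_pM2r ?invr_gt0//.
case: ifPn => _; last by rewrite mule0.
rewrite -EFinD -!EFinM; congr EFin; field.
by rewrite gt_eqF.
Qed.

Lemma ge0_integral_scale (l : R) (f : R -> \bar R) : (0 < l)%R ->
  measurable_fun setT f -> (forall x, 0 <= f x) ->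
  \int[mu]_x f (l * x)%R = (l^-1)%:E * \int[mu]_x f x.
Proof.
move=> l0 mf f0.
have ml : measurable_fun setT (( *%R l) : measurableTypeR R -> measurableTypeR R).
  exact: (measurable_funM (measurable_cst _) (@measurable_id _ _ _)).
pose ml' : {mfun measurableTypeR R >-> measurableTypeR R} := HB.pack ( *%R l)
  (isMeasurableFun.Build _ _ _ _ _ ml).
pose l' : {nonneg R} := NngNum (ltW l0).
have -> : \int[mu]_x f x = \int[mscale l' (pushforward mu ml')]_x f x.
  by move=> m; apply: eq_measure_integral => A mA _; exact: (lebesgue_measure_scale l0 mA).
rewrite ge0_integral_mscale// ge0_integral_pushforward// muleA -EFinM /=.
by rewrite mulVf ?gt_eqF// mul1e.
Qed.

Lemma ge0_integral_opp (f : R -> \bar R) :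
  measurable_fun setT f -> (forall x, 0 <= f x) ->
  \int[mu]_x f (- x)%R = \int[mu]_x f x.
Proof.
move=> mf f0.
have := @ge0_integral_pushforward _ _ _ _ R (-%R : measurableTypeR R -> measurableTypeR R)
  (@oppr_measurable R setT) mu setT f measurableT mf (fun y _ => f0 y).
rewrite preimage_setT => <-.
by apply: eq_measure_integral => A mA _; rewrite -[RHS](lebesgue_measureN mA).
Qed.

End lebesgue_scaling.

Section gamma_integral.
Context {R : realType}.
Notation mu := (@lebesgue_measure R).
Implicit Types s x : R.

(** Extended by [0] to the nonpositive reals, the integrand serves on the whole
    line for both halves of the Levy measure, through scaling and reflection. *)
Definition gamma_fun s (l : R) x : R := if 0 < x then x `^ (s - 1) * expR (- (l * x)) else 0.

Lemma gamma_fun_ge0 s l x : 0 <= gamma_fun s l x.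
Proof. by rewrite /gamma_fun; case: ifP => // _; rewrite mulr_ge0 ?powR_ge0 ?expR_ge0. Qed.

Lemma measurable_gamma_fun s l : measurable_fun setT (gamma_fun s l).
Proof.
apply: measurable_fun_ifT => //; first exact: measurable_fun_ltr.
apply: measurable_funM.
  exact: measurable_powR.
apply: (measurableT_comp (f := fun y : R => expR y)); first exact: measurable_expR.
apply: (measurableT_comp (f := fun y : R => - y)); first exact: oppr_measurable.
exact: (measurable_funM (measurable_cst _) (@measurable_id _ _ _)).
Qed.

Let powR_le_sqr s x : 0 < s <= 2 -> 0 < x -> x `^ s <= 1 + x ^+ 2.
Proof.
move=> /andP[s0 s2] x0; have [x1|x1] := leP x 1.
  apply: (@le_trans _ _ 1); last by rewrite lerDl sqr_ge0.
  by rewrite -[leRHS](powRr0 x) ger_powR ?x0// ltW.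
apply: (@le_trans _ _ (x `^ 2)); first by rewrite ler_powR// ltW.
by rewrite (powR_mulrn 2 (ltW x0)) lerDr.
Qed.

(** The bound is the derivative of the bounded function
    [- 72 / (s (1 + x ^ s))]; it holds because [(1 + x ^ s) ^ 2] is at most
    [72 exp x], and it covers the singularity at [0] and the tail at once. *)
Let gamma_dom s x : 0 < s <= 2 -> 0 < x ->
  x `^ (s - 1) * expR (- x) <= 72 / s * (s * x `^ (s - 1) / (1 + x `^ s) ^+ 2).
Proof.
move=> s02 x0; have /andP[s0 s2] := s02.
set D := (1 + x `^ s) ^+ 2.
have D0 : 0 < D by rewrite exprn_gt0// ltr_wpDr// powR_ge0.
have -> : 72 / s * (s * x `^ (s - 1) / D) = x `^ (s - 1) * (72 / D).
  by field; rewrite !gt_eqF.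
rewrite ler_wpM2l ?powR_ge0// expRN ler_pdivlMr// mulrC ler_pdivrMr ?expR_gt0//.
apply: (@le_trans _ _ ((2 + x ^+ 2) ^+ 2)).
  rewrite lerXn2r ?nnegrE ?addr_ge0 ?powR_ge0 ?sqr_ge0//.
  by have := powR_le_sqr s02 x0; lra.
(* With [y = x ^ 2]: [(2 + y) ^ 2 <= 6 + 3 y ^ 2 <= 72 (1 + y ^ 2 / 24)]. *)
have := expR_ge1Dxn 3 (ltW x0).
rewrite (_ : (3.+1)`! = 24)//.
set y := x ^+ 2.
have -> : x ^+ 3.+1 = y ^+ 2 by rewrite -exprM.
move=> h; nra.
Qed.

Lemma gamma_integral_lty s : 0 < s <= 2 ->
  (\int[mu]_x (gamma_fun s 1 x)%:E < +oo)%E.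
Proof.
move=> s02; have /andP[s0 s2] := s02.
(* The fundamental theorem of calculus is applied on compact intervals: the
   integrand may be singular at [0]. *)
pose I (n : nat) : set R := `[n.+1%:R^-1, n.+2%:R]%classic.
pose g x : R := 72 / s * (s * x `^ (s - 1) / (1 + x `^ s) ^+ 2).
pose G x : R := - (72 / s) * (1 + x `^ s)^-1.
have I0 n x : I n x -> 0 < x.
  by rewrite /I /= in_itv/= => /andP[+ _]; apply: lt_le_trans; rewrite invr_gt0.
have IU : \bigcup_n I n = `]0, +oo[%classic.
  apply/seteqP; split => x; first by move=> [n _ /I0]; rewrite /= in_itv/= andbT.
  rewrite /= in_itv/= andbT => x0.
  have [n1 _ /(_ n1 (leqnn n1)) h1] := near_infty_natSinv_lt (PosNum x0).
  pose n2 := Num.truncn x.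
  have h2 : x < n2.+1%:R by exact: truncnS_gt.
  exists (maxn n1 n2) => //; rewrite /I /= in_itv/=; apply/andP; split.
    apply: (le_trans _ (ltW h1)); rewrite /= lef_pV2 ?posrE// ler_nat ltnS.
    exact: leq_maxl.
  by apply: (le_trans (ltW h2)); rewrite ler_nat ltnS (leq_trans (leq_maxr n1 n2)).
have cP r x : 0 < x -> {for x, continuous (fun y => y `^ r)}.
  move=> x0; apply/differentiable_continuous; rewrite -derivable1_diffP.
  by have [] := is_derive1_powR r x0.
have P0 x : 1 + x `^ s != 0 by rewrite gt_eqF// ltr_wpDr// powR_ge0.
have dG x : 0 < x -> is_derive x 1 G (g x).
  move=> x0.
  have dP : is_derive x 1 (fun y => 1 + y `^ s) (s * x `^ (s - 1)).
    have h := is_derive1_powR s x0.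
    rewrite -[X in is_derive _ _ _ X]add0r.
    exact: (is_deriveD (is_derive_cst _ _ _) h).
  have dV := @is_deriveV R (fun y => 1 + y `^ s) x _ 1 (P0 x) dP.
  have := is_deriveZ (- (72 / s)) dV.
  rewrite /GRing.scale/= => h; apply: is_derive_eq h _.
  by rewrite /g; field; rewrite P0 gt_eqF.
have cg x : 0 < x -> {for x, continuous g}.
  move=> x0; apply: cvgM; first exact: cvg_cst.
  apply: cvgM; first by apply: cvgM; [exact: cvg_cst|exact: cP].
  apply: cvgV; first by rewrite expf_eq0 /= (negbTE (P0 x)).
  have h : 1 + y `^ s @[y --> x] --> 1 + x `^ s by apply: cvgD; [exact: cvg_cst|exact: cP].
  exact: (cvgM h h).
have cG x : 0 < x -> {for x, continuous G}.
  move=> x0; apply/differentiable_continuous; rewrite -derivable1_diffP.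
  by have [] := dG x x0.
have mI n : measurable (I n) by exact: measurable_itv.
have bound n : (\int[mu]_(x in I n) (gamma_fun s 1 x)%:E <= (72 / s)%:E)%E.
  have ab : n.+1%:R^-1 < n.+2%:R :> R.
    by rewrite (@le_lt_trans _ _ 1) ?ltr1n// invf_le1 ?ler1n.
  have a0 : 0 < n.+1%:R^-1 :> R by rewrite invr_gt0.
  have cgI : {within I n, continuous g}.
    by apply: continuous_in_subspaceT => x; rewrite inE => /I0; exact: cg.
  apply: (@le_trans _ _ (\int[mu]_(x in I n) (g x)%:E)%E).
    apply: ge0_le_integral => //.
    - exact: mI.
    - by move=> x _; rewrite lee_fin gamma_fun_ge0.
    - apply/measurable_EFinP; apply: (measurable_funS measurableT) => //.
      exact: measurable_gamma_fun.
    - apply/measurable_EFinP; exact: subspace_continuous_measurable_fun.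
    - move=> x /I0 x0; rewrite lee_fin /gamma_fun x0 mul1r.
      exact: gamma_dom.
  rewrite /I (@continuous_FTC2 _ g G)//.
  - rewrite -EFinB lee_fin /G.
    have h1 : 0 <= (1 + n.+2%:R `^ s)^-1 :> R by rewrite invr_ge0 addr_ge0// powR_ge0.
    have h2 : (1 + n.+1%:R^-1 `^ s)^-1 <= 1 :> R.
      by rewrite invf_le1 ?lerDl ?powR_ge0// ltr_wpDr// powR_ge0.
    have h3 : 0 < 72 / s by rewrite divr_gt0.
    by move: h1 h2 h3; move: (72 / s) (_^-1) (_^-1) => c u v; nra.
  - split.
    + move=> x; rewrite in_itv/= => /andP[ax _].
      by have [] := dG x (lt_trans a0 ax).
    + by apply: cvg_at_right_filter; exact: cG.
    + by apply: cvg_at_left_filter; apply: cG; exact: lt_trans ab.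
  - move=> x; rewrite in_itv/= => /andP[ax _].
    by rewrite derive1E; have [_ ->] := dG x (lt_trans a0 ax).
have h : (\int[mu]_(x in I i) (gamma_fun s 1 x)%:E)%E @[i --> \oo] -->
  (\int[mu]_(x in `]0%R, +oo[) (gamma_fun s 1 x)%:E)%E.
  rewrite -IU; apply: ge0_nondecreasing_set_cvg_integral => //.
  - move=> m n mn; rewrite subsetEset /I => x /=; rewrite !in_itv/= => /andP[mx xm].
    apply/andP; split; first by apply: le_trans mx; rewrite lef_pV2 ?posrE// ler_nat.
    by apply: (le_trans xm); rewrite ler_nat.
  - move=> n; apply/measurable_EFinP; apply: (measurable_funS measurableT) => //.
    exact: measurable_gamma_fun.
  - by move=> n x _; rewrite /= lee_fin gamma_fun_ge0.
have -> : (\int[mu]_x (gamma_fun s 1 x)%:E = \int[mu]_(x in `]0%R, +oo[) (gamma_fun s 1 x)%:E)%E.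
  rewrite [RHS]integral_mkcond; apply: eq_integral => x _; rewrite patchE.
  case: ifPn => //; rewrite notin_setE /= in_itv/= andbT => /negP x0.
  by rewrite /gamma_fun (negbTE x0).
apply: (@le_lt_trans _ _ (72 / s)%:E); last exact: ltry.
have /cvg_lim <- // := h; apply: lime_le; first by apply/cvg_ex; eexists; exact: h.
exact: nearW.
Qed.

Definition gammaE s : \bar R := (\int[mu]_x (gamma_fun s 1 x)%:E)%E.

Lemma GammaRE s : 0 < s <= 2 -> gammaE s = (GammaR s)%:E.
Proof.
move=> s02; rewrite /gammaE /GammaR /Rintegral.
have -> : (\int[mu]_(x in `]0%R, +oo[) (x `^ (s - 1) * expR (- x))%:E =
          \int[mu]_x (gamma_fun s 1 x)%:E)%E.
  rewrite integral_mkcond; apply: eq_integral => x _; rewrite patchE.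
  rewrite /gamma_fun mul1r; case: ifPn.
    by rewrite inE /= in_itv/= andbT => ->.
  by rewrite notin_setE /= in_itv/= andbT => /negP/negbTE ->.
rewrite fineK// ge0_fin_numE ?gamma_integral_lty//.
by apply: integral_ge0 => x _; rewrite lee_fin gamma_fun_ge0.
Qed.

Lemma GammaR_ge0 s : 0 <= GammaR s :> R.
Proof.
by apply: Rintegral_ge0 => x _; rewrite mulr_ge0 ?powR_ge0 ?expR_ge0.
Qed.

(** The substitution [y = l x] turns the rate [l] into the rate [1]. *)
Lemma gamma_integral_rate s l : 0 < s <= 2 -> 0 < l ->
  (\int[mu]_x (gamma_fun s l x)%:E = (l `^ (- s) * GammaR s)%:E)%E.
Proof.
move=> s02 l0; rewrite EFinM -GammaRE// /gammaE.
have -> : (l `^ (- s) = l `^ (1 - s) * l^-1)%R.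
  by rewrite -(powR_inv1 (ltW l0)) -powRD ?(gt_eqF l0) ?implybT//; congr (_ `^ _); ring.
rewrite EFinM -muleA -ge0_integral_scale//; last 2 first.
  - by apply/measurable_EFinP; exact: measurable_gamma_fun.
  - by move=> x; rewrite lee_fin gamma_fun_ge0.
rewrite -ge0_integralZl//; last 3 first.
  - apply/measurable_EFinP.
    apply: (measurableT_comp (f := gamma_fun s 1)); first exact: measurable_gamma_fun.
    exact: (measurable_funM (measurable_cst _) (@measurable_id _ _ _)).
  - by move=> x _; rewrite lee_fin gamma_fun_ge0.
  - by rewrite lee_fin powR_ge0.
apply: eq_integral => x _; rewrite -EFinM; congr EFin.
rewrite /gamma_fun pmulr_rgt0//; case: ifPn => x0; last by rewrite mulr0.
rewrite mul1r mulrA powRM ?ltW// mulrA -powRD ?(gt_eqF l0) ?implybT//.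
by rewrite addrA subrK subrr powRr0 mul1r.
Qed.

End gamma_integral.

(** * The Levy exponent of a tempered stable law *)

Section levy_exponent.
Context {R : realType}.
Variables (alpha a_m a_p l_m l_p : R).
Hypotheses (alpha0 : 0 < alpha) (alpha1 : alpha < 1).
Hypotheses (a_m0 : 0 < a_m) (a_p0 : 0 < a_p) (l_m0 : 0 < l_m) (l_p0 : 0 < l_p).
Notation mu := (@lebesgue_measure R).
Notation rho := (ts_density alpha a_m a_p l_m l_p).

Lemma ts_density_ge0 x : 0 <= rho x.
Proof.
rewrite /ts_density; case: ifP => _.
  by rewrite divr_ge0 ?powR_ge0// mulr_ge0 ?expR_ge0// ltW.
by case: ifP => _ //; rewrite divr_ge0 ?powR_ge0// mulr_ge0 ?expR_ge0// ltW.
Qed.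

Let mpowR (f : R -> R) r : measurable_fun setT f -> measurable_fun setT (fun x => f x `^ r).
Proof.
by move=> mf; apply: (measurableT_comp (f := fun y : R => y `^ r)) => //; exact: measurable_powR.
Qed.

Let mexpR (f : R -> R) : measurable_fun setT f -> measurable_fun setT (fun x => expR (f x)).
Proof.
by move=> mf; apply: (measurableT_comp (f := fun y : R => expR y)) => //; exact: measurable_expR.
Qed.

Let mnorm : measurable_fun setT (fun x : R => `|x|).
Proof. exact: normr_measurable. Qed.

Lemma measurable_ts_density : measurable_fun setT rho.
Proof.
have minv (f : R -> R) r : measurable_fun setT f ->
    measurable_fun setT (fun x => (f x `^ r)^-1).
  move=> mf; have -> : (fun x => (f x `^ r)^-1) = (fun x => f x `^ (- r)).
    by apply/funext => x; rewrite powRN.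
  exact: mpowR.
apply: measurable_fun_ifT; first exact: measurable_fun_ltr.
  apply: measurable_funM; last exact: minv.
  apply: measurable_funM => //; apply: mexpR.
  by apply: measurable_funM => //; exact: measurable_cst.
apply: measurable_fun_ifT => //; first exact: measurable_fun_ltr.
apply: measurable_funM; last exact: minv.
apply: measurable_funM => //; apply: mexpR.
by apply: measurable_funM => //; exact: measurable_cst.
Qed.

Lemma measurable_kappa : measurable_fun setT (@kappa R).
Proof.
apply: measurable_fun_ifT; first exact: measurable_fun_ltr.
  exact: measurable_cst.
have -> : (fun x : R => `|x|^-1) = (fun x => `|x| `^ (-1)).
  by apply/funext => x; rewrite powR_inv1.
exact: mpowR.
Qed.

Lemma kappa_norm_le1 (x : R) : `|kappa x| <= 1.
Proof.
rewrite /kappa; case: ifPn => [_|]; first by rewrite normr1.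
by rewrite -leNgt => x1; rewrite normfV normr_id invf_le1// (lt_le_trans ltr01).
Qed.

(** The closed form of the absolute moment of order [q] of the Levy measure, see
    [levy_momentE]. *)
Definition levy_moment (q : R) : R :=
  (a_m * l_m `^ (alpha - q) + a_p * l_p `^ (alpha - q)) * GammaR (q - alpha).

Lemma levy_moment_ge0 q : 0 <= levy_moment q.
Proof.
by rewrite mulr_ge0 ?GammaR_ge0// addr_ge0// mulr_ge0 ?powR_ge0// ltW.
Qed.

Let moment_density q x : 0 < q ->
  `|x| `^ q * rho x =
  a_p * gamma_fun (q - alpha) l_p x + a_m * gamma_fun (q - alpha) l_m (- x).
Proof.
move=> q0; rewrite /gamma_fun /ts_density oppr_gt0.
have aux (a l y : R) : 0 < y -> y `^ q * (a * expR (- l * y) / y `^ (1 + alpha)) =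
    a * (y `^ (q - alpha - 1) * expR (- (l * y))).
  move=> y0; rewrite mulNr.
  have -> : q - alpha - 1 = q - (1 + alpha) by ring.
  rewrite powRB ?(gt_eqF y0) ?implybT//; ring.
case: (ltgtP x 0) => x0.
- by rewrite mulr0 add0r ltr0_norm// aux// oppr_gt0.
- by rewrite mulr0 addr0 gtr0_norm// aux.
- by rewrite !mulr0 addr0.
Qed.

Lemma levy_momentE q : alpha < q <= 2 ->
  (\int[mu]_x (`|x| `^ q * rho x)%:E = (levy_moment q)%:E)%E.
Proof.
move=> /andP[aq q2]; have q0 : 0 < q by exact: lt_trans aq.
have s02 : 0 < q - alpha <= 2 by rewrite subr_gt0 aq/= lerBlDr (le_trans q2)// lerDl ltW.
under eq_integral do rewrite moment_density//.
have mg l : measurable_fun setT (EFin \o (gamma_fun (q - alpha) l)).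
  by apply/measurable_EFinP; exact: measurable_gamma_fun.
have mgN l : measurable_fun setT (EFin \o (fun x => gamma_fun (q - alpha) l (- x))).
  apply/measurable_EFinP.
  apply: (measurableT_comp (f := gamma_fun (q - alpha) l)); first exact: measurable_gamma_fun.
  exact: oppr_measurable.
have g0 l x : (0 <= (gamma_fun (q - alpha) l x)%:E)%E by rewrite lee_fin gamma_fun_ge0.
under eq_integral do rewrite EFinD !EFinM.
rewrite ge0_integralD//; last 4 first.
- by move=> x _; rewrite mule_ge0// lee_fin ltW.
- by apply: measurable_funeM; exact: mg.
- by move=> x _; rewrite mule_ge0// lee_fin ltW.
- by apply: measurable_funeM; exact: mgN.
rewrite !ge0_integralZl// ?lee_fin ?(ltW a_p0) ?(ltW a_m0)//.
- rewrite (ge0_integral_opp (mg l_m) (g0 l_m)).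
  rewrite !gamma_integral_rate// -!EFinM -EFinD; congr EFin.
  by rewrite /levy_moment !opprB; ring.
- exact: mgN.
- exact: mg.
Qed.

(** [levy_integrable] and [levy_integral_le] reduce every estimate on the exponent
    to a pointwise bound of the integrand by a power of [|x|]. *)
Lemma levy_integrable (h : R -> R) (c q : R) : alpha < q <= 2 ->
  measurable_fun setT h -> (forall x, `|h x| <= c * `|x| `^ q) ->
  mu.-integrable setT (EFin \o (fun x => h x * rho x)).
Proof.
move=> aq mh hc; apply: (@le_integrable _ (measurableTypeR R) R mu setT measurableT (EFin \o (fun x => h x * rho x))
  (EFin \o (fun x => c * (`|x| `^ q * rho x)))).
- by apply/measurable_EFinP/measurable_funM => //; exact: measurable_ts_density.
- move=> x _; rewrite /= lee_fin normrM mulrA (ger0_norm (ts_density_ge0 x)).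
  rewrite normrM (ger0_norm (ts_density_ge0 x)) ler_wpM2r ?ts_density_ge0//.
  exact: le_trans (hc x) (ler_norm _).
have := @integrableZl _ _ _ mu setT measurableT c (EFin \o (fun x => `|x| `^ q * rho x)).
have -> : ((fun x => c%:E * (EFin \o (fun x => (`|x| `^ q * rho x)%R)) x) =
   EFin \o (fun x => (c * (`|x| `^ q * rho x))%R))%E by [].
apply; apply/integrableP; split.
  apply/measurable_EFinP/measurable_funM; last exact: measurable_ts_density.
  exact: mpowR.
under eq_integral => x _.
  rewrite abse_EFin ger0_norm ?mulr_ge0 ?powR_ge0 ?ts_density_ge0//.
  over.
by rewrite levy_momentE// ltry.
Qed.

Lemma levy_integral_le (h : R -> R) (c q : R) : alpha < q <= 2 ->
  measurable_fun setT h -> (forall x, `|h x| <= c * `|x| `^ q) ->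
  `|\int[mu]_x (h x * rho x)| <= c * levy_moment q.
Proof.
move=> aq mh hc; have ih := levy_integrable aq mh hc.
apply: (le_trans (le_normr_Rintegral measurableT ih)).
have mq : measurable_fun setT (fun x : R => `|x| `^ q) by exact: mpowR.
have iq : mu.-integrable setT (EFin \o (fun x => `|x| `^ q * rho x)).
  by apply: (@levy_integrable _ 1 q) => // x; rewrite mul1r ger0_norm ?powR_ge0.
have -> : levy_moment q = \int[mu]_x (`|x| `^ q * rho x).
  by rewrite /Rintegral levy_momentE.
rewrite -RintegralZl//; apply: le_Rintegral => //.
- by have := integrable_abse ih; apply: eq_integrable.
- have := @integrableZl _ _ _ mu setT measurableT c _ iq; exact: eq_integrable.
move=> x _; rewrite normrM (ger0_norm (ts_density_ge0 x)) mulrA.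
by rewrite ler_wpM2r ?ts_density_ge0.
Qed.

Definition psi_re t := \int[mu]_x ((cos (t * x) - 1) * rho x).
Definition psi_im t := \int[mu]_x ((sin (t * x) - kappa x * t * x) * rho x).

Lemma ts_exponentE t : ts_exponent alpha a_m a_p l_m l_p t = psi_re t +i* psi_im t.
Proof.
rewrite /ts_exponent /cintegral; congr (_ +i* _); apply: eq_Rintegral => x _ /=.
  by rewrite !(mul0r, mulr0, mul1r, mulr1, subr0, sub0r, oppr0, addr0, add0r, expR0).
by rewrite !(mul0r, mulr0, mul1r, mulr1, subr0, sub0r, oppr0, addr0, add0r, expR0).
Qed.

Let mscale t : measurable_fun setT (fun x : R => t * x).
Proof. exact: (measurable_funM (measurable_cst _) (@measurable_id _ _ _)). Qed.

Let mcos t : measurable_fun setT (fun x : R => cos (t * x)).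
Proof.
apply: (measurableT_comp (f := fun y : R => cos y)) => //.
by apply: continuous_measurable_fun; exact: continuous_cos.
Qed.

Let msin t : measurable_fun setT (fun x : R => sin (t * x)).
Proof.
apply: (measurableT_comp (f := fun y : R => sin y)) => //.
by apply: continuous_measurable_fun; exact: continuous_sin.
Qed.

Let mre t : measurable_fun setT (fun x : R => cos (t * x) - 1).
Proof. by apply: measurable_funB => //; exact: measurable_cst. Qed.

Let mim t : measurable_fun setT (fun x : R => sin (t * x) - kappa x * t * x).
Proof.
apply: measurable_funB => //; apply: measurable_funM => //.
by apply: measurable_funM => //; exact: measurable_kappa.
Qed.

Let a12 : alpha < 1 <= (2 : R). Proof. by rewrite alpha1 ler1n. Qed.

Let re_le (t x : R) : `|cos (t * x) - 1| <= `|t| * `|x| `^ 1.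
Proof.
rewrite powRr1// -normrM -[X in _ - X]cos0.
by have := cos_dist_le (t * x) 0; rewrite subr0.
Qed.

Let im_dist_le (s t x : R) :
  `|(sin (s * x) - kappa x * s * x) - (sin (t * x) - kappa x * t * x)| <=
  2 * `|s - t| * `|x| `^ 1.
Proof.
rewrite powRr1// -[leRHS]mulrA -normrM.
have -> : (sin (s * x) - kappa x * s * x) - (sin (t * x) - kappa x * t * x) =
  (sin (s * x) - sin (t * x)) - kappa x * ((s - t) * x) by ring.
rewrite (le_trans (ler_normB _ _))// mulr_natl mulr2n lerD//.
  by have := sin_dist_le (s * x) (t * x); rewrite -mulrBl.
by rewrite [leLHS]normrM ler_piMl// kappa_norm_le1.
Qed.

Let ire t : mu.-integrable setT (EFin \o (fun x => (cos (t * x) - 1) * rho x)).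
Proof. exact: levy_integrable a12 (mre t) (re_le t). Qed.

Let iim t : mu.-integrable setT (EFin \o (fun x => (sin (t * x) - kappa x * t * x) * rho x)).
Proof.
apply: (levy_integrable (c := 2 * `|t|) a12 (mim t)) => x.
by have := im_dist_le t 0 x; rewrite mul0r sin0 mulr0 mul0r !subr0.
Qed.

Lemma psi_re_dist_le s t : `|psi_re s - psi_re t| <= `|s - t| * levy_moment 1.
Proof.
rewrite /psi_re -RintegralB//.
under eq_Rintegral do rewrite -mulrBl.
apply: levy_integral_le => //; first exact: measurable_funB.
move=> x; rewrite powRr1// -normrM mulrBl opprB addrA subrK.
exact: cos_dist_le.
Qed.

Lemma psi_im_dist_le s t : `|psi_im s - psi_im t| <= 2 * `|s - t| * levy_moment 1.
Proof.
rewrite /psi_im -RintegralB//.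
under eq_Rintegral do rewrite -mulrBl.
by apply: levy_integral_le => //; exact: measurable_funB.
Qed.

Lemma psi_re0 : psi_re 0 = 0.
Proof.
by rewrite /psi_re; under eq_Rintegral do rewrite mul0r cos0 subrr mul0r;
   rewrite Rintegral_cst// mul0r.
Qed.

Lemma psi_im0 : psi_im 0 = 0.
Proof.
by rewrite /psi_im; under eq_Rintegral do rewrite mul0r sin0 mulr0 mul0r subrr mul0r;
   rewrite Rintegral_cst// mul0r.
Qed.

Lemma psi_re_bound t : - (t ^+ 2 * (levy_moment 2 / 2)) <= psi_re t <= 0.
Proof.
have h x : `|cos (t * x) - 1| <= t ^+ 2 / 2 * `|x| `^ 2.
  rewrite distrC ger0_norm ?subr_ge0 ?cos_le1//.
  apply: (le_trans (one_sub_cos_le _)).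
  rewrite (powR_mulrn 2 (normr_ge0 x)) real_normK ?num_real// exprMn.
  by rewrite [leRHS]mulrAC.
have a22 : alpha < 2 <= (2 : R) by rewrite lexx andbT (lt_trans alpha1)// ltr1n.
have := levy_integral_le a22 (mre t) h.
rewrite -/(psi_re t) ler_norml => /andP[h1 _]; apply/andP; split.
  by apply: le_trans h1; rewrite lerN2 mulrAC mulrA.
rewrite -oppr_ge0 /psi_re -[leRHS]mulN1r -RintegralZl//.
apply: Rintegral_ge0 => x _; rewrite mulrA mulr_ge0 ?ts_density_ge0// mulN1r opprB.
Qed.

Section codifference_bound.
Variables (p : R) (p1 : 1 <= p) (p2 : p <= 2).

Let aq : alpha < p <= 2. Proof. by rewrite p2 (lt_le_trans alpha1). Qed.

Let sin_sin_le (s t x c : R) : `|c| <= 1 ->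
  `|4 * sin (s * x / 2) * sin (t * x / 2) * c| <=
  2 `^ (2 - p) * `|s| `^ (p / 2) * `|t| `^ (p / 2) * `|x| `^ p.
Proof.
move=> c1.
have q01 : 0 <= p / 2 <= 1.
  by apply/andP; split; [rewrite divr_ge0// (le_trans ler01)|rewrite ler_pdivrMr// mul1r].
have hs := sin_abs_le_powR (s * x / 2) q01.
have ht := sin_abs_le_powR (t * x / 2) q01.
rewrite !normrM (ger0_norm (_ : (0 : R) <= 4))//.
apply: (@le_trans _ _ (4 * `|sin (s * x / 2)| * `|sin (t * x / 2)|)).
  by rewrite ler_piMr// !mulr_ge0.
apply: (@le_trans _ _ (4 * (`|s * x / 2| `^ (p / 2) * `|t * x / 2| `^ (p / 2)))).
  by rewrite -mulrA ler_wpM2l// ler_pM.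
rewrite le_eqVlt; apply/orP; left; apply/eqP.
rewrite !normrM !powRM ?mulr_ge0// (ger0_norm (_ : (0 : R) <= 2^-1))//.
have -> : `|x| `^ p = `|x| `^ (p / 2) * `|x| `^ (p / 2).
  have [->|x0] := eqVneq x 0.
    rewrite normr0 !powR0 ?mulr0//; first by rewrite gt_eqF// divr_gt0// (lt_le_trans ltr01).
    by rewrite gt_eqF// (lt_le_trans ltr01).
  by rewrite -powRD ?normr_eq0 ?(negbTE x0) ?implybT// -splitr.
have -> : 2 `^ (2 - p) = 4 * (2^-1 `^ (p / 2) * 2^-1 `^ (p / 2)).
  rewrite -powRD ?invr_eq0 ?pnatr_eq0 ?implybT// -splitr.
  rewrite -(powR_inv1 (_ : (0 : R) <= 2))// -powRrM mulN1r.
  rewrite powRD ?pnatr_eq0 ?implybT//; congr (_ * _).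
  by rewrite (powR_mulrn 2)// expr2 -natrM.
ring.
Qed.

Let half_angles (s t x : R) : [/\ (s - t) * x = (s * x / 2 - t * x / 2) *+ 2,
  s * x = (s * x / 2) *+ 2 & - t * x = - ((t * x / 2) *+ 2)].
Proof. by split; rewrite -mulr_natr; field. Qed.

(** With [u = s x / 2] and [v = t x / 2], the product of [exp (i s x) - 1] and
    [exp (- i t x) - 1] is [4 sin u sin v exp (i (u - v))]. *)
Let cos_codiff (s t x : R) : cos ((s - t) * x) - cos (s * x) - cos (- t * x) + 1 =
  4 * sin (s * x / 2) * sin (t * x / 2) * cos (s * x / 2 - t * x / 2).
Proof.
have [e1 e2 e3] := half_angles s t x.
rewrite e1 e3 [X in _ - cos X - _]e2 cosN !cos_mulr2n.
move: (s * x / 2) (t * x / 2) => u v; rewrite cosB.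
set cu := cos u; set su := sin u; set cv := cos v; set sv := sin v.
transitivity (4 * su * sv * (cu * cv + su * sv) +
  2 * ((1 - cu ^+ 2) * (1 - cv ^+ 2) - su ^+ 2 * sv ^+ 2)); first by ring.
by rewrite /cu /cv -!sin2cos2 subrr mulr0 addr0.
Qed.

Let sin_codiff (s t x : R) : sin ((s - t) * x) - sin (s * x) - sin (- t * x) =
  4 * sin (s * x / 2) * sin (t * x / 2) * sin (s * x / 2 - t * x / 2).
Proof.
have [e1 e2 e3] := half_angles s t x.
rewrite e1 e3 [X in _ - sin X - _]e2 sinN !sin_mulr2n.
move: (s * x / 2) (t * x / 2) => u v; rewrite cosB sinB.
set cu := cos u; set su := sin u; set cv := cos v; set sv := sin v.
transitivity (4 * su * sv * (su * cv - cu * sv) +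
  2 * (su * cu * (cv ^+ 2 + sv ^+ 2 - 1) - sv * cv * (cu ^+ 2 + su ^+ 2 - 1))); first by ring.
by rewrite !cos2Dsin2 subrr !mulr0 subrr mulr0 addr0.
Qed.

Lemma psi_re_codiff s t :
  `|psi_re (s - t) - psi_re s - psi_re (- t)| <=
  2 `^ (2 - p) * `|s| `^ (p / 2) * `|t| `^ (p / 2) * levy_moment p.
Proof.
have i2 : mu.-integrable setT (EFin \o (fun x => (cos ((s - t) * x) - 1) * rho x -
    (cos (s * x) - 1) * rho x)).
  exact: (@eq_integrable _ _ _ _ _ measurableT _ _ _ (integrableB measurableT (ire _) (ire _))).
rewrite /psi_re -!RintegralB//.
under eq_Rintegral do rewrite -!mulrBl.
apply: levy_integral_le => //.
  by apply: measurable_funB => //; exact: measurable_funB.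
move=> x.
have -> : cos ((s - t) * x) - 1 - (cos (s * x) - 1) - (cos (- t * x) - 1) =
    cos ((s - t) * x) - cos (s * x) - cos (- t * x) + 1 by ring.
by rewrite cos_codiff; apply: sin_sin_le; rewrite cos_max.
Qed.

Lemma psi_im_codiff s t :
  `|psi_im (s - t) - psi_im s - psi_im (- t)| <=
  2 `^ (2 - p) * `|s| `^ (p / 2) * `|t| `^ (p / 2) * levy_moment p.
Proof.
have i2 : mu.-integrable setT (EFin \o (fun x =>
    (sin ((s - t) * x) - kappa x * (s - t) * x) * rho x -
    (sin (s * x) - kappa x * s * x) * rho x)).
  exact: (@eq_integrable _ _ _ _ _ measurableT _ _ _ (integrableB measurableT (iim _) (iim _))).
rewrite /psi_im -!RintegralB//.
under eq_Rintegral do rewrite -!mulrBl.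
apply: levy_integral_le => //.
  by apply: measurable_funB => //; exact: measurable_funB.
move=> x.
have -> : sin ((s - t) * x) - kappa x * (s - t) * x - (sin (s * x) - kappa x * s * x) -
    (sin (- t * x) - kappa x * - t * x) =
    sin ((s - t) * x) - sin (s * x) - sin (- t * x) by ring.
by rewrite sin_codiff; apply: sin_sin_le; rewrite sin_max.
Qed.

End codifference_bound.
End levy_exponent.

(** * Moments of a tempered stable law *)

Section complex_exponential.
Context {R : realType}.

Lemma cexp_imag (t : R) : cexp ('i * t%:C) = cos t +i* sin t.
Proof.
rewrite /cexp /=.
by rewrite !(mul0r, mulr0, mul1r, subr0, sub0r, oppr0, addr0, add0r, expR0).
Qed.

Lemma bounded_integrable d (T : measurableType d) (P : probability T R) (f : T -> R) (c : R) :
  measurable_fun setT f -> (forall x, `|f x| <= c) -> P.-integrable setT (EFin \o f).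
Proof.
move=> mf fc; apply: (@le_integrable _ _ _ _ _ measurableT _ (EFin \o cst c)).
- exact/measurable_EFinP.
- by move=> x _; rewrite /= lee_fin (le_trans (fc x))// ler_norm.
- exact: finite_measure_integrable_cst.
Qed.

Lemma measurable_cos_comp d (T : measurableType d) (f : T -> R) :
  measurable_fun setT f -> measurable_fun setT (fun x => cos (f x)).
Proof.
move=> mf; apply: (measurableT_comp (f := fun y : R => cos y)) => //.
by apply: continuous_measurable_fun; exact: continuous_cos.
Qed.

Lemma ae_measure_eq d (T : measurableType d) (P : {measure set T -> \bar R}) (A B : set T) :
  measurable A -> measurable B -> {ae P, forall x, A x <-> B x} -> P A = P B.
Proof.
move=> mA mB [Z [mZ Z0 sub]].
have aux (A' B' : set T) : measurable A' -> measurable B' ->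
    (forall x, ~ (A x <-> B x) -> Z x) -> (forall x, ~ Z x -> A' x -> B' x) -> (P A' <= P B')%E.
  move=> mA' mB' _ AB.
  apply: (@le_trans _ _ (P (B' `|` Z))).
    apply: le_measure; rewrite ?inE//; first exact: measurableU.
    by move=> x A'x; have [Zx|nZx] := pselect (Z x); [right|left; exact: AB].
  have h : (P (B' `|` Z) <= P B' + P Z)%E by exact: measureU2.
  by apply: (le_trans h); rewrite Z0 adde0.
have nZ x : ~ Z x -> (A x <-> B x).
  by move=> nZx; apply: contrapT => h; apply: nZx; exact: sub.
apply/eqP; rewrite eq_le; apply/andP; split; apply: aux => // x /nZ [h1 h2] //.
Qed.

End complex_exponential.

Section tempered_stable_moments.
Context {R : realType}.
Variables (alpha a_m a_p l_m l_p : R).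
Hypotheses (alpha0 : 0 < alpha) (alpha1 : alpha < 1).
Hypotheses (a_m0 : 0 < a_m) (a_p0 : 0 < a_p) (l_m0 : 0 < l_m) (l_p0 : 0 < l_p).
Variable nu : probability (measurableTypeR R) R.
Hypothesis nu_ts : tempered_stable alpha a_m a_p l_m l_p nu.
Notation A := (psi_re alpha a_m a_p l_m l_p).
Notation B := (psi_im alpha a_m a_p l_m l_p).
Notation M := (levy_moment alpha a_m a_p l_m l_p).

Lemma charf_trig t :
  \int[nu]_x cos (t * x) = expR (A t) * cos (B t) /\
  \int[nu]_x sin (t * x) = expR (A t) * sin (B t).
Proof.
have := nu_ts t; rewrite ts_exponentE /cintegral /cexp => -[h1 h2].
split; [rewrite -h1|rewrite -h2]; apply: eq_Rintegral => x _;
  by rewrite /= !(mul0r, mulr0, mul1r, subr0, sub0r, oppr0, addr0, add0r, expR0).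
Qed.

Let C : R := M 2 / 2 + (2 * M 1) ^+ 2 / 2.

(** With [a] and [b] the real and imaginary parts of the exponent and [a <= 0],
    [1 - exp a cos b] is at most [- a + b ^ 2 / 2]; here [a] is of second order
    at [0] and [b] of first order. *)
Let one_sub_re_charf t : 1 - \int[nu]_x cos (t * x) <= t ^+ 2 * C.
Proof.
have [-> _] := charf_trig t.
have /andP[A1 A2] := psi_re_bound alpha0 alpha1 a_m0 a_p0 l_m0 l_p0 t.
have := psi_im_dist_le alpha0 alpha1 a_m0 a_p0 l_m0 l_p0 t 0.
rewrite psi_im0 !subr0 => B1.
have eA : 1 + A t <= expR (A t) by exact: expR_ge1Dx.
have eA1 : expR (A t) <= 1 by rewrite -expR0 ler_expR.
have eA0 : 0 <= expR (A t) by exact: expR_ge0.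
have cB : 1 - cos (B t) <= t ^+ 2 * ((2 * M 1) ^+ 2 / 2).
  apply: (le_trans (one_sub_cos_le _)).
  rewrite mulrA -exprMn ler_pM2r ?invr_gt0//.
  rewrite -(real_normK (num_real (B t))) -[leRHS](real_normK (num_real _)).
  rewrite lerXn2r ?nnegrE//.
  by apply: (le_trans B1); rewrite normrM mulrAC mulrC ler_wpM2l// ler_norm.
have cB0 : 0 <= 1 - cos (B t) by rewrite subr_ge0 cos_le1.
have -> : 1 - expR (A t) * cos (B t) = (1 - expR (A t)) + expR (A t) * (1 - cos (B t)) by ring.
have cB' : expR (A t) * (1 - cos (B t)) <= 1 - cos (B t) by rewrite ler_piMl.
by rewrite [leRHS]mulrDr; lra.
Qed.

Let mcosn t : nu.-integrable setT (EFin \o (fun x => cos (t * x))).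
Proof.
apply: (@bounded_integrable _ _ _ nu _ 1); first exact: measurable_cos_comp.
by move=> x; exact: cos_max.
Qed.

(** Where [|x| <= n + 1], [x ^ 2] is at most [8 (n + 1) ^ 2 (1 - cos (x / (n + 1)))],
    whose integral is bounded uniformly in [n] by [one_sub_re_charf]. *)
Lemma nu_second_moment : (\int[nu]_x (x ^+ 2)%:E < +oo)%E.
Proof.
pose F (n : nat) : set (measurableTypeR R) := [set x | `|x| <= n.+1%:R].
have mF n : measurable (F n).
  rewrite -[X in measurable X]setTI; exact: measurable_fun_le.
have FU : \bigcup_n F n = setT.
  apply/seteqP; split => // x _; exists (Num.truncn `|x|) => //.
  by rewrite /F /= ltW// truncnS_gt.
have mx2 D : measurable_fun D (fun x : measurableTypeR R => (x ^+ 2)%:E).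
  apply/measurable_EFinP; apply: measurable_funX; exact: measurable_id.
have bound n : (\int[nu]_(x in F n) (x ^+ 2)%:E <= (8 * C)%:E)%E.
  have n0 : (0 : R) < n.+1%:R by [].
  pose t : R := n.+1%:R^-1.
  have t0 : 0 < t by rewrite invr_gt0.
  have i1 : nu.-integrable setT (EFin \o (fun x => 1 - cos (t * x))).
    apply: (@bounded_integrable _ _ _ nu _ 2).
      by apply: measurable_funB; [exact: measurable_cst|exact: measurable_cos_comp].
    move=> x; rewrite (le_trans (ler_normB _ _))// normr1.
    by have := cos_max (t * x); lra.
  have mI : measurable_fun setT (fun x : measurableTypeR R => (8 * n.+1%:R ^+ 2 * (1 - cos (t * x)))%:E).
    apply/measurable_EFinP; apply: measurable_funM; first exact: measurable_cst.
    by apply: measurable_funB; [exact: measurable_cst|exact: measurable_cos_comp].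
  have nn x : (0 <= (8 * n.+1%:R ^+ 2 * (1 - cos (t * x)))%:E)%E.
    by rewrite lee_fin !mulr_ge0 ?sqr_ge0// subr_ge0 cos_le1.
  apply: (@le_trans _ _ (\int[nu]_(x in F n) (8 * n.+1%:R ^+ 2 * (1 - cos (t * x)))%:E)%E).
    apply: ge0_le_integral => //.
    - by move=> x _; rewrite lee_fin sqr_ge0.
    - exact: measurable_funS mI.
    - move=> x Fx; rewrite lee_fin.
      have tx : `|t * x| <= 1.
        by rewrite normrM gtr0_norm// /t mulrC ler_pdivrMr// mul1r.
      have := one_sub_cos_ge tx.
      have -> : (t * x) ^+ 2 / 8 = x ^+ 2 / (8 * n.+1%:R ^+ 2).
        rewrite exprMn /t exprVn; move: (n.+1%:R : R) n0 => m m0.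
        by field; rewrite gt_eqF.
      by rewrite ler_pdivrMr ?mulr_gt0 ?exprn_gt0// mulrC.
  apply: (@le_trans _ _ (\int[nu]_x (8 * n.+1%:R ^+ 2 * (1 - cos (t * x)))%:E)%E).
    by apply: ge0_subset_integral => // x _; exact: nn.
  under eq_integral do rewrite EFinM.
  rewrite integralZl//.
  have -> : (\int[nu]_x (1 - cos (t * x))%:E)%E = (1 - \int[nu]_x cos (t * x))%:E.
    have := RintegralB measurableT (finite_measure_integrable_cst nu 1 measurableT) (mcosn t).
    have nT : fine (nu setT) = 1 by rewrite probability_setT.
    have -> : \int[nu]_x (cst 1 x) = 1 by rewrite -[RHS]nT Rintegral_cst// mul1r.
    move=> <-; rewrite /Rintegral fineK//; exact: integrable_fin_num.
  rewrite -EFinM lee_fin.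
  apply: (@le_trans _ _ (8 * n.+1%:R ^+ 2 * (t ^+ 2 * C))).
    by rewrite ler_wpM2l// mulr_ge0// sqr_ge0.
  rewrite le_eqVlt; apply/orP; left; apply/eqP; rewrite /t exprVn.
  by move: (n.+1%:R : R) n0 => m m0; field; rewrite gt_eqF.
have h : (\int[nu]_(x in F n) (x ^+ 2)%:E)%E @[n --> \oo] --> (\int[nu]_x (x ^+ 2)%:E)%E.
  rewrite -FU; apply: ge0_nondecreasing_set_cvg_integral => //.
  - move=> m n mn; rewrite subsetEset /F => x /= xm.
    by apply: (le_trans xm); rewrite ler_nat.
  - by move=> n x _; rewrite lee_fin sqr_ge0.
apply: (@le_lt_trans _ _ (8 * C)%:E); last exact: ltry.
have /cvg_lim <- // := h; apply: lime_le; first by apply/cvg_ex; eexists; exact: h.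
exact: nearW.
Qed.

Lemma nu_first_moment : (\int[nu]_x `|x|%:E < +oo)%E.
Proof.
apply: (@le_lt_trans _ _ (\int[nu]_x (1 + x ^+ 2)%:E)%E).
  apply: ge0_le_integral => //.
  - by apply/measurable_EFinP; exact: normr_measurable.
  - apply/measurable_EFinP; apply: measurable_funD; first exact: measurable_cst.
    by apply: measurable_funX; exact: measurable_id.
  - move=> x _; rewrite lee_fin -(real_normK (num_real x)).
    by have := sqr_ge0 (`|x| - 1); have := sqr_ge0 (`|x|); nra.
under eq_integral do rewrite EFinD.
rewrite ge0_integralD//.
- by rewrite integral_cst//= probability_setT mul1e lte_add_pinfty ?ltry ?nu_second_moment.
- by move=> x _; rewrite lee_fin sqr_ge0.
- by apply/measurable_EFinP; apply: measurable_funX; exact: measurable_id.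
Qed.

End tempered_stable_moments.

(** * Convergence and law of the random series *)

Section random_series_law.
Context {R : realType} {p : R} {p1 : 1 <= p}.
Notation E := (lp p1).
Variable k : nat -> R.
Hypotheses (k_gt0 : forall n, 0 < k n) (k_sum : (\sum_(n <oo) (k n)%:E < +oo)%E).
Variable nu : probability (measurableTypeR R) R.
Hypothesis nu1 : (\int[nu]_x `|x|%:E < +oo)%E.
Context d (Omega : measurableType d) (P : probability Omega R).
Variables (th1 th2 : nat -> {RV P >-> R}).
Notation th := (fun bn : bool * nat => if bn.1 then th1 bn.2 else th2 bn.2).
Hypothesis th_indep : mutually_independent th.
Hypotheses (th1_law : forall n, same_law nu (th1 n)) (th2_law : forall n, same_law nu (th2 n)).

Let p_gt0 : 0 < p. Proof. exact: lt_le_trans p1. Qed.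

Let mth1 n : measurable_fun setT (th1 n : Omega -> R). Proof. exact: measurable_funPT. Qed.
Let mth2 n : measurable_fun setT (th2 n : Omega -> R). Proof. exact: measurable_funPT. Qed.

Let u (o : Omega) (n : nat) : R[i] := (k n)%:C * (th1 n o +i* th2 n o).

Let uE o n : u o n = (k n * th1 n o) +i* (k n * th2 n o).
Proof. by rewrite /u; apply/eqP; rewrite eq_complex /= !mul0r subr0 addr0 !eqxx. Qed.

Let same_law_abs_moment (X : {RV P >-> R}) : same_law nu X ->
  (\int[P]_o (`|X o|)%:E = \int[nu]_x `|x|%:E)%E.
Proof.
move=> Xnu.
have mabs : measurable_fun setT (fun x : measurableTypeR R => `|x|%:E).
  by apply/measurable_EFinP; exact: normr_measurable.
have mX : measurable_fun setT (X : Omega -> measurableTypeR R).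
  exact: (measurable_funPT X).
pose X' : {mfun Omega >-> measurableTypeR R} := HB.pack (X : Omega -> measurableTypeR R)
  (isMeasurableFun.Build _ _ _ _ _ mX).
have -> : (\int[nu]_x `|x|%:E = \int[distribution P X']_x `|x|%:E)%E.
  by apply: eq_measure_integral => A mA _; exact/esym/Xnu.
by rewrite ge0_integral_distribution// => y; rewrite lee_fin.
Qed.

(** The expectation of this series is the sum of the weights times twice the
    first absolute moment of [nu]. *)
Let series_ae_lty :
  {ae P, forall o, (\sum_(n <oo) (k n * (`|th1 n o| + `|th2 n o|))%:E < +oo)%E}.
Proof.
pose f n o := ((k n * (`|th1 n o| + `|th2 n o|))%:E : \bar R).
have mf n : measurable_fun setT (f n).
  apply/measurable_EFinP; apply: measurable_funM; first exact: measurable_cst.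
  by apply: measurable_funD; apply: (measurableT_comp (f := fun y : R => `|y|)) => //;
    exact: normr_measurable.
have f0 n o : (0 <= f n o)%E by rewrite lee_fin mulr_ge0 ?addr_ge0// ltW.
have int_f n : (\int[P]_o f n o = (k n)%:E * (\int[nu]_x `|x|%:E + \int[nu]_x `|x|%:E))%E.
  rewrite -{1}(same_law_abs_moment (th1_law n)) -(same_law_abs_moment (th2_law n)).
  have mabs (X : {RV P >-> R}) : measurable_fun setT (fun o => `|X o|%:E : \bar R).
    apply/measurable_EFinP; apply: (measurableT_comp (f := fun y : R => `|y|)).
      exact: normr_measurable.
    exact: measurable_funPT.
  rewrite -ge0_integralD// -ge0_integralZl//.
  - by apply: emeasurable_funD.
  - by move=> o _; rewrite adde_ge0.
  - by rewrite lee_fin ltW.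
pose F o := (\sum_(n <oo) f n o)%E.
have F0 o : (0 <= F o)%E by apply: nneseries_ge0 => n _ _; exact: f0.
have iF : P.-integrable setT F.
  apply/integrableP; split.
    by apply: (ge0_emeasurable_sum (P := xpredT)).
  under eq_integral do rewrite gee0_abs//.
  rewrite integral_nneseries//.
  under eq_eseriesr do rewrite int_f.
  have cst0 : (0 <= \int[nu]_x `|x|%:E)%E by apply: integral_ge0 => x _; rewrite lee_fin.
  have cst_fin : (\int[nu]_x `|x|%:E)%E \is a fin_num by rewrite ge0_fin_numE.
  rewrite -(fineK cst_fin) -EFinD.
  under eq_eseriesr do rewrite muleC.
  rewrite nneseriesZl//; last by move=> n _; rewrite lee_fin ltW.
  by rewrite lte_mul_pinfty// lee_fin addr_ge0// fine_ge0.
have := integrable_ae measurableT iF.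
by apply: filterS => o /(_ I); rewrite ge0_fin_numE.
Qed.

Let u_in_lp : {ae P, forall o, u o \in in_lp p}.
Proof.
apply: filterS series_ae_lty => o h; apply/(@in_lpP _ _ p1).
apply: (@summable_powR _ (fun n => rnorm (u o n : R[i]^o)) p p1) => [n|].
  exact: rnorm_ge0.
apply: le_lt_trans h; apply: lee_nneseries => n.
  by move=> _ _; rewrite lee_fin rnorm_ge0.
move=> _; rewrite lee_fin mulrDr; apply: (le_trans (rnorm_le_ReIm _)).
by rewrite uE /= !normrM (gtr0_norm (k_gt0 n)).
Qed.

Let X (o : Omega) : borel E := insubd (0 : E) (u o).

Let XE o n : (X o : E) n = if u o \in in_lp p then u o n else 0.
Proof.
have : \val (insubd (0 : E) (u o) : E) = if u o \in in_lp p then u o else \val (0 : E).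
  exact: val_insubd.
by rewrite /X => ->; case: ifP.
Qed.

Let mX : measurable_fun setT X.
Proof.
have mu1 n : measurable_fun setT (fun o => complex.Re (u o n)).
  under eq_fun do rewrite uE/=.
  by apply: measurable_funM => //; exact: measurable_cst.
have mu2 n : measurable_fun setT (fun o => complex.Im (u o n)).
  under eq_fun do rewrite uE/=.
  by apply: measurable_funM => //; exact: measurable_cst.
have mB : measurable_fun setT (fun o => u o \in in_lp p).
  have -> : (fun o => u o \in in_lp p) =
      (fun o => (\sum_(n <oo) ((rnorm (u o n : R[i]^o)) `^ p)%:E < cst +oo o)%E).
    by apply/funext => o; apply/idP/idP => /(@in_lpP _ _ p1).
  apply: measurable_fun_lte; last exact: measurable_cst.
  apply: (ge0_emeasurable_sum (P := xpredT)) => [n o _ _|n _].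
    by rewrite lee_fin powR_ge0.
  apply/measurable_EFinP.
  apply: (measurableT_comp (f := fun x : R => x `^ p)); first exact: measurable_powR.
  under eq_fun do rewrite rnormCE.
  apply: (measurableT_comp (f := fun x : R => Num.sqrt x)).
    by apply: continuous_measurable_fun; exact: sqrt_continuous.
  by apply: measurable_funD; exact: measurable_funX.
apply: lp_measurable_fun => n; under eq_fun do rewrite XE fun_if.
  by apply: measurable_fun_ifT => //; exact: measurable_cst.
by apply: measurable_fun_ifT => //; exact: measurable_cst.
Qed.

(** The sum is the sequence of the terms where it belongs to [lp], and [0]
    elsewhere; it is measurable because its coordinates are. *)
Lemma exists_series_sum :
  exists X : {RV P >-> borel E}, is_series_sum k th1 th2 X.
Proof.
pose X' : {mfun Omega >-> borel E} := HB.pack X (isMeasurableFun.Build _ _ _ _ _ mX).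
exists X'; apply: filterS u_in_lp => o uo.
have -> : (fun N => \sum_(n < N) ((k n)%:C * (th1 n o +i* th2 n o)) *: lp_basis p1 n) =
    lp_trunc (X o : E).
  apply/funext => N; apply: lp_eqP => m; rewrite -/(lp_trunc (u o) N) !lp_truncE.
  by rewrite XE uo.
exact: lp_trunc_cvg.
Qed.

Section law.
Variable Y : {RV P >-> borel E}.
Hypothesis Y_sum : is_series_sum k th1 th2 Y.

Let Y_coord : {ae P, forall o, forall i, lpc i (Y o) = k i.2 * th i o}.
Proof.
apply: filterS Y_sum => o cvgY.
have YE m : (Y o : E) m = u o m.
  apply/eqP; rewrite -subr_eq0; apply/eqP; apply: rnorm_eq0; apply/eqP.
  rewrite eq_le rnorm_ge0 andbT leNgt; apply/negP => e0.
  have := continuous_cvg_seq (@lp_coord_continuous _ _ p1 m) cvgY.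
  move=> /cvg_rnormP/(_ _ e0)[N _ hN].
  have := hN (maxn N m.+1) (leq_maxl _ _).
  rewrite -/(lp_trunc (u o) (maxn N m.+1)) lp_truncE leq_maxr.
  by rewrite ltxx.
by case=> [[] n]; rewrite /lpc /= YE uE.
Qed.

(** Convergence in [lp] implies convergence of each coordinate, so the coordinates
    of [Y] are almost surely the terms of the series. *)
Lemma series_law_cylinder (s : seq (bool * nat)) (B : bool * nat -> set R) :
  uniq s -> (forall i, measurable (B i)) ->
  distribution P Y (\bigcap_(i in [set` s]) (lpc i @^-1` B i)) =
  (\prod_(i <- s) nu [set t | B i (k i.2 * t)%R])%E.
Proof.
move=> us mB.
pose B' (i : bool * nat) : set R := [set t | B i (k i.2 * t)].
have mB' i : measurable (B' i).
  rewrite -[X in measurable X]setTI.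
  by apply: (measurable_funM (measurable_cst _) (@measurable_id _ _ _)).
have mth i : measurable_fun setT (th i : Omega -> R) by case: ifP.
transitivity (P (\bigcap_(i in [set` s]) (th i @^-1` B' i))).
  apply: (@ae_measure_eq R _ Omega P (Y @^-1` \bigcap_(i in [set` s]) (lpc i @^-1` B i))).
  - rewrite -[X in measurable X]setTI; apply: (measurable_funPT Y) => //.
    apply: (measurable_cylinders (J := setT) measurable_lpc).
    by exists s, B.
  - apply: fin_bigcap_measurable => // i _.
    by rewrite -[X in measurable X]setTI; exact: mth.
  apply: filterS Y_coord => o oE; split => h i is_; have := h i is_;
    by rewrite /= oE.
rewrite th_indep//; apply: eq_bigr => i _.
rewrite -[RHS]/(nu (B' i)); case: i => [[] n] /=.
  by rewrite -(th1_law n (mB' (true, n))).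
by rewrite -(th2_law n (mB' (false, n))).
Qed.

End law.
End random_series_law.

(** * Characteristic functions of independent coordinates *)

Section independent_integrals.
Context {R : realType} d (T : measurableType d) (P : probability T R).

(** The joint law of [U] and [V] is the product of their laws, so that the
    theorem of Fubini applies. *)
Lemma indep_Rintegral_mul (U V : T -> R) (f g : R -> R) (cf cg : R) :
  measurable_fun setT U -> measurable_fun setT V ->
  (forall A B : set R, measurable A -> measurable B ->
    P (U @^-1` A `&` V @^-1` B) = (P (U @^-1` A) * P (V @^-1` B))%E) ->
  measurable_fun setT f -> measurable_fun setT g ->
  (forall x, `|f x| <= cf) -> (forall x, `|g x| <= cg) ->
  \int[P]_t (f (U t) * g (V t)) = (\int[P]_t f (U t)) * (\int[P]_t g (V t)).
Proof.
move=> mU mV UV mf mg fb gb.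
have mU1 : measurable_fun setT (U : T -> measurableTypeR R) by exact: mU.
have mV1 : measurable_fun setT (V : T -> measurableTypeR R) by exact: mV.
pose U' : {mfun T >-> measurableTypeR R} := HB.pack (U : T -> measurableTypeR R)
  (isMeasurableFun.Build _ _ _ _ _ mU1).
pose V' : {mfun T >-> measurableTypeR R} := HB.pack (V : T -> measurableTypeR R)
  (isMeasurableFun.Build _ _ _ _ _ mV1).
pose W : T -> measurableTypeR R * measurableTypeR R := fun t => (U t, V t).
have mW : measurable_fun setT W by exact/measurable_fun_pairP.
pose W' : {mfun T >-> (measurableTypeR R * measurableTypeR R)%type} := HB.pack W
  (isMeasurableFun.Build _ _ _ _ _ mW).
pose h (z : measurableTypeR R * measurableTypeR R) : R := f z.1 * g z.2.
have mf' : measurable_fun setT (f : measurableTypeR R -> R) by exact: mf.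
have mg' : measurable_fun setT (g : measurableTypeR R -> R) by exact: mg.
have mh : measurable_fun setT h.
  apply: measurable_funM.
    exact: (measurableT_comp mf' (@measurable_fst _ _ _ _)).
  exact: (measurableT_comp mg' (@measurable_snd _ _ _ _)).
have hb z : `|h z| <= cf * cg by rewrite normrM ler_pM.
have dW A : measurable A -> (distribution P U' \x distribution P V')%E A = distribution P W' A.
  apply: product_measure_unique => A1 A2 mA1 mA2.
  exact: UV.
have ih (Q : probability (measurableTypeR R * measurableTypeR R)%type R) :
    Q.-integrable setT (EFin \o h) by exact: bounded_integrable.
have cV : (\int[distribution P V']_y (g y)%:E)%E = (\int[P]_t g (V t))%:E.
  rewrite integral_distribution//; last 2 first.
    by apply/measurable_EFinP.
    by apply: (@bounded_integrable _ _ _ P _ cg) => //; exact: measurableT_comp.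
  rewrite /Rintegral fineK//; apply: integrable_fin_num => //.
  by apply: (@bounded_integrable _ _ _ P _ cg) => //; exact: measurableT_comp.
have cU : (\int[distribution P U']_y (f y)%:E)%E = (\int[P]_t f (U t))%:E.
  rewrite integral_distribution//; last 2 first.
    by apply/measurable_EFinP.
    by apply: (@bounded_integrable _ _ _ P _ cf) => //; exact: measurableT_comp.
  rewrite /Rintegral fineK//; apply: integrable_fin_num => //.
  by apply: (@bounded_integrable _ _ _ P _ cf) => //; exact: measurableT_comp.
apply: EFin_inj.
transitivity (\int[distribution P W']_z (h z)%:E)%E.
  rewrite integral_distribution//; last 2 first.
    by apply/measurable_EFinP.
    by apply: (@bounded_integrable _ _ _ P _ (cf * cg)) => //; exact: measurableT_comp.
  rewrite /Rintegral fineK//; apply: integrable_fin_num => //.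
  by apply: (@bounded_integrable _ _ _ P (fun t => h (W t)) (cf * cg)) => //; exact: measurableT_comp.
transitivity (\int[distribution P U' \x distribution P V']_z (h z)%:E)%E.
  by apply: eq_measure_integral => A mA _; exact/esym/dW.
rewrite -integral12_prod_meas1; last first.
  apply/integrableP; split; first exact/measurable_EFinP.
  have -> : (\int[distribution P U' \x distribution P V']_x `|(EFin \o h) x|)%E =
    (\int[distribution P W']_x `|(EFin \o h) x|)%E.
    by apply: eq_measure_integral => A mA _; exact: dW.
  by have /integrableP[] := ih (distribution P W').
rewrite /fubini_F /h /=.
under eq_integral => x _.
  under eq_integral do rewrite EFinM.
  rewrite integralZl//; last by apply: (@bounded_integrable _ _ _ (distribution P V') _ cg).
  rewrite cV muleC; over.
rewrite integralZl//; last by apply: (@bounded_integrable _ _ _ (distribution P U') _ cf).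
by rewrite cU -EFinM mulrC.
Qed.

End independent_integrals.

Section finite_charfunctional.
Context {R : realType} {p : R} {p1 : 1 <= p}.
Notation E := (lp p1).
Variables (alpha a_m a_p l_m l_p : R).
Variable nu : probability (measurableTypeR R) R.
Hypothesis nu_ts : tempered_stable alpha a_m a_p l_m l_p nu.
Notation A := (psi_re alpha a_m a_p l_m l_p).
Notation B := (psi_im alpha a_m a_p l_m l_p).
Variables (k : nat -> R) (mu : probability (borel E) R).
Hypothesis mu_cyl : forall (s : seq (bool * nat)) (B : bool * nat -> set R),
  uniq s -> (forall i, measurable (B i)) ->
  mu (\bigcap_(i in [set` s]) (lpc i @^-1` B i)) =
  (\prod_(i <- s) nu [set t | B i (k i.2 * t)%R])%E.

Let mlpcM (b : R) i : measurable_fun setT (fun z : borel E => b * lpc i z).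
Proof. by apply: measurable_funM; [exact: measurable_cst|exact: measurable_lpc]. Qed.

Let law_Rintegral (f : R -> R) (c : R) i : measurable_fun setT f ->
  (forall x, `|f x| <= c) ->
  \int[mu]_z f (lpc i z) = \int[nu]_t f (k i.2 * t).
Proof.
move=> mf fc.
have mc1 : measurable_fun setT (lpc i : borel E -> measurableTypeR R).
  exact: (@measurable_lpc _ _ p1 i).
pose C : {mfun borel E >-> measurableTypeR R} := HB.pack (lpc i : borel E -> measurableTypeR R)
  (isMeasurableFun.Build _ _ _ _ _ mc1).
have mk1 : measurable_fun setT (( *%R (k i.2)) : measurableTypeR R -> measurableTypeR R).
  exact: (measurable_funM (measurable_cst _) (@measurable_id _ _ _)).
pose K : {mfun measurableTypeR R >-> measurableTypeR R} := HB.pack ( *%R (k i.2))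
  (isMeasurableFun.Build _ _ _ _ _ mk1).
have mf' : measurable_fun setT (f : measurableTypeR R -> R) by exact: mf.
congr fine.
transitivity (\int[distribution mu C]_x (f x)%:E)%E.
  rewrite integral_distribution//; first exact/measurable_EFinP.
  by apply: (@bounded_integrable _ _ _ mu _ c) => //; exact: measurableT_comp.
transitivity (\int[distribution nu K]_x (f x)%:E)%E.
  apply: eq_measure_integral => D mD _.
  exact: (lpc_law mu_cyl i mD).
rewrite integral_distribution//; first exact/measurable_EFinP.
by apply: (@bounded_integrable _ _ _ nu _ c) => //; exact: measurableT_comp.
Qed.

Let mcos : measurable_fun setT (@cos R).
Proof. by apply: continuous_measurable_fun; exact: continuous_cos. Qed.
Let msin : measurable_fun setT (@sin R).
Proof. by apply: continuous_measurable_fun; exact: continuous_sin. Qed.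

Let coord_cos_sin (b : R) i :
  \int[mu]_z cos (b * lpc i z) = expR (A (k i.2 * b)) * cos (B (k i.2 * b)) /\
  \int[mu]_z sin (b * lpc i z) = expR (A (k i.2 * b)) * sin (B (k i.2 * b)).
Proof.
have [h1 h2] := charf_trig nu_ts (k i.2 * b).
have mb : measurable_fun setT ( *%R b).
  exact: (measurable_funM (measurable_cst _) (@measurable_id _ _ _)).
split.
  rewrite -h1 (@law_Rintegral (fun x => cos (b * x)) 1)//.
  - by apply: eq_Rintegral => t _; rewrite mulrA (mulrC b).
  - exact: (measurableT_comp mcos mb).
  - by move=> x; exact: cos_max.
rewrite -h2 (@law_Rintegral (fun x => sin (b * x)) 1)//.
- by apply: eq_Rintegral => t _; rewrite mulrA (mulrC b).
- exact: (measurableT_comp msin mb).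
- by move=> x; exact: sin_max.
Qed.

Definition lin_comb (s : seq (bool * nat)) (b : bool * nat -> R) (z : borel E) : R :=
  \sum_(i <- s) b i * lpc i z.

Lemma measurable_lin_comb s b : measurable_fun setT (lin_comb s b).
Proof. by apply: measurable_sum => i; exact: mlpcM. Qed.

(** By independence the characteristic functions of the coordinates multiply. *)
Lemma charf_lin_comb (s : seq (bool * nat)) (b : bool * nat -> R) : uniq s ->
  let a := \sum_(i <- s) A (k i.2 * b i) in
  let c := \sum_(i <- s) B (k i.2 * b i) in
  \int[mu]_z cos (lin_comb s b z) = expR a * cos c /\
  \int[mu]_z sin (lin_comb s b z) = expR a * sin c.
Proof.
elim: s => [_|i s IH /= /andP[is_ us]].
  rewrite /= /lin_comb; under eq_Rintegral do rewrite big_nil cos0.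
  under [X in _ /\ X = _]eq_Rintegral do rewrite big_nil sin0.
  have mT : fine (mu setT) = 1 by rewrite probability_setT.
  by rewrite !Rintegral_cst// !big_nil expR0 cos0 sin0 !mul1r mul0r.
have [IHc IHs] := IH us.
have [Cc Cs] := coord_cos_sin (b i) i.
rewrite !big_cons.
have lcE z : lin_comb (i :: s) b z = b i * lpc i z + lin_comb s b z by rewrite /lin_comb big_cons.
have mV : measurable_fun setT (fun z : borel E => b i * lpc i z) by exact: mlpcM.
have mU := measurable_lin_comb s b.
have VU (D1 D2 : set R) : measurable D1 -> measurable D2 ->
    mu ((fun z : borel E => b i * lpc i z) @^-1` D1 `&` lin_comb s b @^-1` D2) =
    (mu ((fun z : borel E => (b i * lpc i z)%R) @^-1` D1) * mu (lin_comb s b @^-1` D2))%E.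
  move=> mD1 mD2.
  apply: (sigma_cylinders_indep measurable_lpc (lpc_indep mu_cyl)
    (J1 := [set i]) (J2 := [set` s])).
  - by apply/seteqP; split => // j /= [-> js]; rewrite js in is_.
  - have := @measurable_funM _ (g_sigma_algebraType (cylinders (@lpc R p p1) [set i])) R setT
      (cst (b i)) (lpc i) (measurable_cst _) (measurable_coord_cylinders (erefl i)).
    by move=> /(_ measurableT D1 mD1); rewrite setTI.
  - pose h j (z : g_sigma_algebraType (cylinders (@lpc R p p1) [set` s])) : R :=
      if j \in s then b j * lpc j z else 0.
    have mh j : measurable_fun setT (h j).
      rewrite /h; have [js|js] := boolP (j \in s); last exact: measurable_cst.
      apply: measurable_funM; first exact: measurable_cst.
      exact: measurable_coord_cylinders.
    have -> : lin_comb s b = (fun z => \sum_(j <- s) h j z).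
      by apply/funext => z; apply: eq_big_seq => j js; rewrite /h js.
    by have := measurable_sum s mh measurableT mD2; rewrite setTI.
have intP (f g : R -> R) : measurable_fun setT f -> measurable_fun setT g ->
    (forall x, `|f x| <= 1) -> (forall x, `|g x| <= 1) ->
    mu.-integrable setT (EFin \o (fun z => f (b i * lpc i z) * g (lin_comb s b z))).
  move=> mf mg f1 g1; apply: (@bounded_integrable _ _ _ mu _ 1).
    by apply: measurable_funM; [exact: (measurableT_comp mf mV)|exact: (measurableT_comp mg mU)].
  by move=> z; rewrite normrM mulr_ile1.
have mulE (f g : R -> R) : measurable_fun setT f -> measurable_fun setT g ->
    (forall x, `|f x| <= 1) -> (forall x, `|g x| <= 1) ->
    \int[mu]_z (f (b i * lpc i z) * g (lin_comb s b z)) =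
    (\int[mu]_z f (b i * lpc i z)) * (\int[mu]_z g (lin_comb s b z)).
  by move=> mf mg f1 g1; exact: (indep_Rintegral_mul mV mU VU mf mg f1 g1).
have cm := @cos_max R; have sm := @sin_max R.
split.
  under eq_Rintegral do rewrite lcE cosD.
  rewrite RintegralB//; [|exact: intP..].
  rewrite !mulE// Cc Cs IHc IHs expRD cosD; ring.
under eq_Rintegral do rewrite lcE sinD.
rewrite RintegralD//; [|exact: intP..].
rewrite !mulE// Cc Cs IHc IHs expRD sinD; ring.
Qed.

End finite_charfunctional.

(** * Continuous logarithms and functionals on lp *)

Section dominated_series.
Context {R : realType}.

Lemma dominated_series (u v : R^nat) : (forall n, `|u n| <= v n) ->
  (\sum_(n <oo) (v n)%:E < +oo)%E ->
  cvgn (series u) /\ (`|limn (series u)|%:E <= \sum_(n <oo) (v n)%:E)%E.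
Proof.
move=> uv voo.
have v0 n : 0 <= v n by exact: le_trans (uv n).
have V0 : (0 <= \sum_(n <oo) (v n)%:E)%E by apply: nneseries_ge0 => n _ _; rewrite lee_fin.
have Vf : (\sum_(n <oo) (v n)%:E)%E \is a fin_num by rewrite ge0_fin_numE.
set V := (\sum_(n <oo) (v n)%:E)%E in voo V0 Vf *.
have sv N : series v N <= fine V.
  rewrite -lee_fin fineK// /series/= -sumEFin.
  by apply: (@nneseries_lim_ge _ (EFin \o v) xpredT 0 N) => k _ _; rewrite lee_fin.
have cv : cvgn (series v).
  apply: nondecreasing_is_cvgn.
    by apply/nondecreasing_seqP => n; rewrite /series/= big_nat_recr//= lerDl.
  by exists (fine V) => _ [N _ <-].
have cu : cvgn (series u).
  apply: normed_cvg; apply: (@series_le_cvg _ (fun n => `|u n|) v) => //.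
split=> //; rewrite -(fineK Vf) lee_fin ler_norml.
have su N : `|series u N| <= fine V.
  apply: le_trans (sv N); rewrite /series/=; apply: (le_trans (ler_norm_sum _ _ _)).
  exact: ler_sum.
apply/andP; split.
  by apply: limr_ge => //; apply: nearW => N; have := su N; rewrite ler_norml => /andP[].
by apply: limr_le => //; apply: nearW => N; have := su N; rewrite ler_norml => /andP[].
Qed.

End dominated_series.

Section continuous_logarithm.
Context {R : realType}.

Let cexp_inj_norm (a b : R[i]) : cexp a = cexp b ->
  complex.Re a = complex.Re b /\ cos (complex.Im a - complex.Im b) = 1.
Proof.
case: a b => [a1 a2] [b1 b2] /= [h1 h2].
have sq (x y : R) : (expR x * cos y) ^+ 2 + (expR x * sin y) ^+ 2 = expR x ^+ 2.
  by rewrite !exprMn -mulrDr cos2Dsin2 mulr1.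
have e1 : expR a1 = expR b1.
  have : expR a1 ^+ 2 = expR b1 ^+ 2 by rewrite -(sq a1 a2) -(sq b1 b2) h1 h2.
  by move/eqP; rewrite eqrXn2// ?expR_ge0// => /eqP.
split; first exact: expR_inj.
have b10 : expR b1 != 0 by rewrite gt_eqF// expR_gt0.
rewrite e1 in h1 h2.
by rewrite cosB (mulfI b10 h1) (mulfI b10 h2) -!expr2 cos2Dsin2.
Qed.

(** A continuous real function vanishing at [0] whose cosine is constantly [1]
    cannot leave [0]: otherwise its absolute value would reach [pi]. *)
Let cos1_continuous (f : R -> R) : continuous f -> f 0 = 0 ->
  (forall t, cos (f t) = 1) -> f 1 = 0.
Proof.
move=> cf f0 cos1.
have cos_abs t : cos `|f t| = 1.
  by case: (ger0P (f t)) => _; rewrite ?cosN cos1.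
have [f1|f1] := leP `|f 1| pi.
  apply/eqP; rewrite -normr_eq0; apply/eqP.
  apply: (@cos_inj R); rewrite ?in_itv/= ?normr_ge0 ?lexx ?pi_ge0//.
  by rewrite cos_abs cos0.
have cg : {within `[(0 : R), 1], continuous (fun t => `|f t|)}.
  apply: continuous_subspaceT => t.
  by apply: cvg_norm; exact: cf.
have [|c _ fc] := @IVT R (fun t => `|f t|) 0 1 pi ler01 cg.
  by rewrite f0 normr0 min_l// max_r// pi_ge0 ltW.
have := cos_abs c; rewrite fc cospi => h.
by exfalso; lra.
Qed.

(** Two such logarithms differ by a continuous function with values in the
    multiples of [2 pi i]; along the segment from [0] to [v] it stays at [0]. *)
Lemma clogE (V : normedModType R[i]) (phi : V -> R[i]) (L : V -> R[i]^o) :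
  continuous L -> L 0 = 0 -> (forall v, cexp (L v) = phi v) -> clog phi = L.
Proof.
move=> cL L0 Lphi.
have ex : [set L : V -> R[i]^o |
    [/\ continuous L, L 0 = 0 & forall v, cexp (L v) = phi v]] !=set0 by exists L.
have := getPex ex; rewrite -/(clog phi) => -[cL' L'0 L'phi].
move: (clog phi) cL' L'0 L'phi => L' cL' L'0 L'phi.
apply/funext => v.
have cIm (F : V -> R[i]^o) : continuous F -> continuous (fun t : R => complex.Im (F (t%:C *: v))).
  move=> cF t; apply/cvgrPdist_lt => e e0.
  have /cvg_rnormP/(_ _ e0)/nbhs_rnormP[del del0 hdel] := cF (t%:C *: v).
  have v1 : 0 < rnorm v + 1 by rewrite ltr_wpDl// rnorm_ge0.
  apply/nbhs_normP; exists (del / (rnorm v + 1)); first by rewrite /= divr_gt0.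
  move=> s /= ts; apply: (le_lt_trans _ (hdel (s%:C *: v) _)).
    by apply: le_trans (Im_le_rnorm _); case: (F _) (F _) => ? ? [].
  rewrite -scalerBl -rmorphB rnormZ rnorm_real.
  rewrite ltr_pdivlMr// in ts; apply: le_lt_trans ts.
  by rewrite ler_wpM2l// lerDl.
pose f t := complex.Im (L' (t%:C *: v)) - complex.Im (L (t%:C *: v)).
have eqL (t : R) : cexp (L' (t%:C *: v)) = cexp (L (t%:C *: v)) by rewrite Lphi L'phi.
have f1 : f 1 = 0.
  apply: cos1_continuous.
  - by move=> t; apply: cvgB; exact: cIm.
  - by rewrite /f scale0r L0 L'0 subrr.
  - by move=> t; have [] := cexp_inj_norm (eqL t).
have [re1 _] := cexp_inj_norm (eqL 1).
move: re1 f1; rewrite /f scale1r.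
by case: (L' v) (L v) => [a b] [a' b'] /= -> /eqP; rewrite subr_eq0 => /eqP ->.
Qed.

End continuous_logarithm.

Section dual_coordinates.
Context {R : realType}.

(** The supremum defining the dual norm is finite because a continuous functional
    is bounded on some ball around [0]. *)
Lemma rnorm_dual_ge (V : normedModType R[i]) (f : dual V) (z : V) :
  rnorm z <= 1 -> rnorm (f z) <= rnorm f.
Proof.
move=> z1.
have /in_dualP[lf cf] := dual_funP f.
have fZ (a : R[i]) y : f (a *: y) = a *: f y.
  have f00 : f 0 = 0.
    by have := lf (-1) 0 0; rewrite scaler0 addr0 scaleN1r addNr.
  by have := lf a y 0; rewrite f00 !addr0.
have f0 : f 0 = 0 by rewrite -(scale0r (0 : V)) fZ scale0r.
have -> : rnorm f = sup [set rnorm (f z) | z in [set z : V | rnorm z <= 1]] by [].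
apply: ub_le_sup; last by exists z.
have /cvg_rnormP/(_ _ ltr01)/nbhs_rnormP[del del0 hdel] := cf 0.
exists (2 / del) => _ [y /= y1 <-].
have d20 : 0 < del / 2 by rewrite divr_gt0.
have := hdel ((del / 2)%:C *: y); rewrite sub0r rnormN rnormZ rnorm_real gtr0_norm//.
have h1 : del / 2 * rnorm y < del.
  apply: (@le_lt_trans _ _ (del / 2)); first by rewrite ler_piMr// ltW.
  by rewrite ltr_pdivrMr// ltr_pMr// ltr1n.
move=> /(_ h1); rewrite f0 sub0r rnormN fZ rnormZ rnorm_real gtr0_norm// => h2.
rewrite ltW//; rewrite -ltr_pdivlMl// in h2.
by apply: (lt_le_trans h2); rewrite mulr1 invf_div.
Qed.

Context {p : R} {p1 : 1 <= p}.
Notation E := (lp p1).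
Implicit Types x y : dual E.

(** The coefficients of the real functional [Re x] on the real coordinates; the
    sign comes from [Re (a b) = Re a Re b - Im a Im b]. *)
Definition dual_coef (x : dual E) (i : bool * nat) : R :=
  if i.1 then complex.Re (x (lp_basis p1 i.2)) else - complex.Im (x (lp_basis p1 i.2)).

Lemma dual_coef_le x i : `|dual_coef x i| <= rnorm x.
Proof.
apply: (le_trans _ (rnorm_dual_ge x (_ : rnorm (lp_basis p1 i.2) <= 1))).
  by rewrite /dual_coef; case: ifP => _; rewrite ?normrN ?Re_le_rnorm ?Im_le_rnorm.
by rewrite rnorm_lp_basis.
Qed.

Lemma dual_coefB x y i : dual_coef (x - y) i = dual_coef x i - dual_coef y i.
Proof.
rewrite /dual_coef (_ : (x - y) _ = x (lp_basis p1 i.2) - y (lp_basis p1 i.2))//.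
by case: (x _) (y _) => [a b] [c d] /=; case: ifP => // _; ring.
Qed.

Lemma dual_coefN x i : dual_coef (- x) i = - dual_coef x i.
Proof.
rewrite /dual_coef (_ : (- x) _ = - x (lp_basis p1 i.2))//.
by case: (x _) => [a b] /=; case: ifP.
Qed.

Lemma dual_coef0 i : dual_coef 0 i = 0.
Proof. by have := dual_coefB 0 0 i; rewrite !subrr. Qed.

Definition coords N : seq (bool * nat) :=
  [seq (true, n) | n <- iota 0 N] ++ [seq (false, n) | n <- iota 0 N].

Lemma coords_uniq N : uniq (coords N).
Proof.
rewrite cat_uniq !map_inj_uniq ?iota_uniq//=; last 2 first.
- by move=> ? ? [].
- by move=> ? ? [].
by rewrite andbT; apply/hasPn => _ /mapP[n _ ->]; apply/mapP => -[].
Qed.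

Lemma sum_coords (V : nmodType) N (F : bool * nat -> V) :
  \sum_(i <- coords N) F i = \sum_(0 <= n < N) (F (true, n) + F (false, n)).
Proof. by rewrite big_cat/= !big_map big_split /index_iota subn0. Qed.

Lemma Re_dual_cvg x (z : E) :
  lin_comb (coords N) (dual_coef x) z @[N --> \oo] --> complex.Re (x z).
Proof.
have /in_dualP[lf cf] := dual_funP x.
pose X : {linear E -> R[i]^o} :=
  HB.pack (x : E -> R[i]^o) (GRing.isLinear.Build _ _ _ _ (x : E -> R[i]^o) lf).
have xE N : lin_comb (coords N) (dual_coef x) z = complex.Re (x (lp_trunc z N)).
  rewrite -[x (lp_trunc z N)]/(X (lp_trunc z N)) /lp_trunc linear_sum.
  have -> : complex.Re (\sum_(n < N) X (z n *: lp_basis p1 n)) =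
      \sum_(n < N) complex.Re (X (z n *: lp_basis p1 n)).
    by elim/big_rec2: _ => // n a b _ <-; case: (X _) b => ? ? [].
  rewrite /lin_comb sum_coords big_mkord; apply: eq_bigr => n _.
  rewrite linearZ/= /dual_coef /lpc /=.
  by case: (z n) (x (lp_basis p1 n)) => [a b] [c d] /=; ring.
have /cvg_rnormP h := continuous_cvg_seq cf (@lp_trunc_cvg _ _ _ z).
apply/cvgrPdist_lt => e e0; have := h _ e0; apply: filterS => N.
rewrite xE; apply: le_lt_trans.
by apply: le_trans (Re_le_rnorm _); case: (x z) (x (lp_trunc z N)) => ? ? [].
Qed.

End dual_coordinates.

(** * The logarithm of the characteristic functional *)

Section log_charfunctional.
Context {R : realType} {p : R} {p1 : 1 <= p}.
Notation E := (lp p1).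
Variables (alpha a_m a_p l_m l_p : R).
Hypotheses (alpha0 : 0 < alpha) (alpha1 : alpha < 1).
Hypotheses (a_m0 : 0 < a_m) (a_p0 : 0 < a_p) (l_m0 : 0 < l_m) (l_p0 : 0 < l_p).
Notation A := (psi_re alpha a_m a_p l_m l_p).
Notation B := (psi_im alpha a_m a_p l_m l_p).
Notation M := (levy_moment alpha a_m a_p l_m l_p).
Variable k : nat -> R.
Hypotheses (k_gt0 : forall n, 0 < k n) (k_sum : (\sum_(n <oo) (k n)%:E < +oo)%E).

Let kE : R := fine (\sum_(n <oo) (k n)%:E)%E.

Let kEE : (\sum_(n <oo) (k n)%:E = kE%:E)%E.
Proof.
rewrite fineK// ge0_fin_numE//; apply: nneseries_ge0 => n _ _.
by rewrite lee_fin ltW.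
Qed.

Let k_sumZ (c : R) : 0 <= c -> (\sum_(n <oo) (c * k n)%:E = (c * kE)%:E)%E.
Proof.
move=> c0; rewrite EFinM -kEE -nneseriesZl//.
  by move=> n _; rewrite lee_fin ltW.
Qed.

Definition log_term (F : R -> R) (x : dual E) (n : nat) : R :=
  F (k n * dual_coef x (true, n)) + F (k n * dual_coef x (false, n)).

Definition log_series (F : R -> R) (x : dual E) : R := limn (series (log_term F x)).

Section lipschitz.
Variables (F : R -> R) (c : R).
Hypotheses (c0 : 0 <= c) (F0 : F 0 = 0).
Hypothesis Flip : forall s t, `|F s - F t| <= c * `|s - t|.

Let log_term_dist x y n : `|log_term F x n - log_term F y n| <= 2 * c * rnorm (x - y) * k n.
Proof.
have h i : `|F (k n * dual_coef x i) - F (k n * dual_coef y i)| <= c * rnorm (x - y) * k n.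
  apply: (le_trans (Flip _ _)); rewrite -mulrBr -dual_coefB normrM (gtr0_norm (k_gt0 n)).
  by rewrite -mulrA ler_wpM2l// mulrC ler_wpM2r ?dual_coef_le// ltW.
rewrite /log_term opprD addrACA (le_trans (ler_normD _ _))//.
have := h (true, n); have := h (false, n); lra.
Qed.

Lemma log_term0 n : log_term F 0 n = 0.
Proof. by rewrite /log_term !dual_coef0 mulr0 F0 addr0. Qed.

Lemma log_series_cvg x : cvgn (series (log_term F x)).
Proof.
have h n : `|log_term F x n| <= 2 * c * rnorm x * k n.
  by have := log_term_dist x 0 n; rewrite log_term0 !subr0.
by have [|] := dominated_series h; first by rewrite k_sumZ ?ltry// !mulr_ge0// rnorm_ge0.
Qed.

Lemma log_series_dist x y :
  `|log_series F x - log_series F y| <= 2 * c * kE * rnorm (x - y).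
Proof.
have [|cv] := dominated_series (log_term_dist x y).
  by rewrite k_sumZ ?ltry// !mulr_ge0// rnorm_ge0.
rewrite k_sumZ ?lee_fin; last by rewrite !mulr_ge0// rnorm_ge0.
rewrite /log_series -limB; [|exact: log_series_cvg..].
have -> : series (log_term F x) - series (log_term F y) =
    series (fun n => log_term F x n - log_term F y n).
  by apply/funext => N; rewrite fctE /series/= sumrB.
by rewrite -!mulrA (mulrC kE).
Qed.

Lemma log_series0 : log_series F 0 = 0.
Proof.
rewrite /log_series; have -> : series (log_term F 0) = cst 0.
  by apply/funext => N; rewrite /series/= big1// => n _; exact: log_term0.
exact: lim_cst.
Qed.

End lipschitz.

Definition log_charf (x : dual E) : R[i]^o := log_series A x +i* log_series B x.

Let A0 : A 0 = 0. Proof. exact: psi_re0. Qed.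
Let B0 : B 0 = 0. Proof. exact: psi_im0. Qed.
Let M0 : 0 <= M 1. Proof. exact: levy_moment_ge0. Qed.
Let Alip s t : `|A s - A t| <= M 1 * `|s - t|.
Proof. by rewrite mulrC; exact: psi_re_dist_le. Qed.
Let Blip s t : `|B s - B t| <= (2 * M 1) * `|s - t|.
Proof. by rewrite mulrAC; exact: psi_im_dist_le. Qed.
Let M20 : 0 <= 2 * M 1. Proof. by rewrite mulr_ge0. Qed.

Lemma log_charf_continuous : continuous log_charf.
Proof.
apply: (@lipschitz_rnorm_continuous _ (dual E) R[i]^o _ (2 * M 1 * kE + 2 * (2 * M 1) * kE)) => x y.
apply: (le_trans (rnorm_le_ReIm _)); rewrite /log_charf /= mulrDl.
by apply: lerD; exact: log_series_dist.
Qed.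

Lemma log_charf0 : log_charf 0 = 0.
Proof. by rewrite /log_charf !log_series0. Qed.

Lemma log_charf_cvgA x : cvgn (series (log_term A x)).
Proof. exact: log_series_cvg M0 A0 Alip x. Qed.

Lemma log_charf_cvgB x : cvgn (series (log_term B x)).
Proof. exact: log_series_cvg M20 B0 Blip x. Qed.

Variable nu : probability (measurableTypeR R) R.
Hypothesis nu_ts : tempered_stable alpha a_m a_p l_m l_p nu.
Variable mu : probability (borel E) R.
Hypothesis mu_cyl : forall (s : seq (bool * nat)) (B : bool * nat -> set R),
  uniq s -> (forall i, measurable (B i)) ->
  mu (\bigcap_(i in [set` s]) (lpc i @^-1` B i)) =
  (\prod_(i <- s) nu [set t | B i (k i.2 * t)%R])%E.

Let series_coords (F : R -> R) x N :
  \sum_(i <- coords N) F (k i.2 * dual_coef x i) = series (log_term F x) N.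
Proof. by rewrite sum_coords. Qed.

Let measurable_Re_dual (x : dual E) : measurable_fun setT (fun z : borel E => complex.Re (x z)).
Proof.
apply: (@measurable_fun_cvg _ (borel E) R setT (fun N => lin_comb (coords N) (dual_coef x))).
- by move=> N; exact: measurable_lin_comb.
- by move=> z _; exact: Re_dual_cvg.
Qed.

Let Rintegral_trig_cvg (f : R -> R) x : continuous f -> (forall t, `|f t| <= 1) ->
  \int[mu]_z f (lin_comb (coords N) (dual_coef x) z) @[N --> \oo] -->
  \int[mu]_z f (complex.Re (x z)).
Proof.
move=> cf f1.
have mf : measurable_fun setT f by exact: continuous_measurable_fun.
have mN N : measurable_fun setT (fun z => f (lin_comb (coords N) (dual_coef x) z)).
  by apply: measurableT_comp => //; exact: measurable_lin_comb.
have mL : measurable_fun setT (fun z : borel E => f (complex.Re (x z))).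
  by apply: measurableT_comp => //; exact: measurable_Re_dual.
have [||||| _ _ h] := @dominated_convergence _ (borel E) R mu setT measurableT
  (fun N z => (f (lin_comb (coords N) (dual_coef x) z))%:E)
  (fun z => (f (complex.Re (x z)))%:E) (EFin \o cst 1).
- by move=> N; exact/measurable_EFinP.
- exact/measurable_EFinP.
- apply: aeW => z _; apply: cvg_EFin; first exact: nearW.
  by apply: continuous_cvg; [exact: cf|exact: Re_dual_cvg].
- exact: finite_measure_integrable_cst.
- by apply: aeW => z N _; rewrite /= lee_fin.
apply: fine_cvg; rewrite /Rintegral fineK; first exact: h.
apply: integrable_fin_num => //.
exact: (@bounded_integrable _ _ _ mu _ 1).
Qed.

(** Exact on the first [N] pairs of coordinates by [charf_lin_comb]; the integrands
    are bounded by [1], so dominated convergence gives the limit. *)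
Lemma charfunctionalE (x : dual E) : charfunctional mu x = cexp (log_charf x).
Proof.
rewrite /charfunctional /cintegral /log_charf [RHS]/cexp.
have cA : expR (series (log_term A x) N) @[N --> \oo] --> expR (log_series A x).
  by apply: continuous_cvg; [exact: continuous_expR|exact: log_charf_cvgA].
congr (_ +i* _).
  transitivity (\int[mu]_z cos (complex.Re (x z))).
    by apply: eq_Rintegral => z _; rewrite cexp_imag.
  have h := @Rintegral_trig_cvg (@cos R) x (@continuous_cos R) (@cos_max R).
  have h2 : (fun N => \int[mu]_z cos (lin_comb (coords N) (dual_coef x) z)) @ \oo -->
      expR (log_series A x) * cos (log_series B x).
    under eq_fun => N.
      have [-> _] := charf_lin_comb nu_ts mu_cyl (dual_coef x) (coords_uniq N).
      rewrite !series_coords; over.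
    apply: cvgM => //.
    by apply: continuous_cvg; [exact: continuous_cos|exact: log_charf_cvgB].
  by rewrite -(cvg_lim _ h2)// -(cvg_lim _ h).
transitivity (\int[mu]_z sin (complex.Re (x z))).
  by apply: eq_Rintegral => z _; rewrite cexp_imag.
have h := @Rintegral_trig_cvg (@sin R) x (@continuous_sin R) (@sin_max R).
have h2 : (fun N => \int[mu]_z sin (lin_comb (coords N) (dual_coef x) z)) @ \oo -->
    expR (log_series A x) * sin (log_series B x).
  under eq_fun => N.
    have [_ ->] := charf_lin_comb nu_ts mu_cyl (dual_coef x) (coords_uniq N).
    rewrite !series_coords; over.
  apply: cvgM => //.
  by apply: continuous_cvg; [exact: continuous_sin|exact: log_charf_cvgB].
by rewrite -(cvg_lim _ h2)// -(cvg_lim _ h).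
Qed.

Lemma clog_charfunctional : clog (charfunctional mu) = log_charf.
Proof.
apply: clogE; [exact: log_charf_continuous|exact: log_charf0|].
by move=> x; rewrite charfunctionalE.
Qed.

End log_charfunctional.

(** * Codifferences along the orbit of the adjoint *)

Section codifference_of_series.
Context {R : realType} {p : R} {p1 : 1 <= p} (p2 : p <= 2).
Notation E := (lp p1).
Variables (alpha a_m a_p l_m l_p : R).
Hypotheses (alpha0 : 0 < alpha) (alpha1 : alpha < 1).
Hypotheses (a_m0 : 0 < a_m) (a_p0 : 0 < a_p) (l_m0 : 0 < l_m) (l_p0 : 0 < l_p).
Notation A := (psi_re alpha a_m a_p l_m l_p).
Notation B := (psi_im alpha a_m a_p l_m l_p).
Notation M := (levy_moment alpha a_m a_p l_m l_p).
Variables (w k : nat -> R).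
Hypotheses (k_gt0 : forall n, 0 < k n) (k_sum : (\sum_(n <oo) (k n)%:E < +oo)%E).
Hypothesis kS : forall n, k n = w n * k n.+1.
Context (T : {linear E -> E}) (T_cont : continuous T)
  (T_e0 : T (lp_basis p1 0) = 0)
  (T_eS : forall n, T (lp_basis p1 n.+1) = (w n)%:C *: lp_basis p1 n).
Variables (nu : probability (measurableTypeR R) R) (mu : probability (borel E) R).
Hypothesis nu_ts : tempered_stable alpha a_m a_p l_m l_p nu.
Hypothesis mu_cyl : forall (s : seq (bool * nat)) (B : bool * nat -> set R),
  uniq s -> (forall i, measurable (B i)) ->
  mu (\bigcap_(i in [set` s]) (lpc i @^-1` B i)) =
  (\prod_(i <- s) nu [set t | B i (k i.2 * t)%R])%E.

Let p_gt0 : 0 < p. Proof. exact: lt_le_trans p1. Qed.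
Let h := p / 2.
Let h_gt0 : 0 < h. Proof. by rewrite divr_gt0. Qed.

Let ss n l : R := k l `^ h * k (l + n)%N `^ h.
Let S n := (\sum_(l <oo) (ss n l)%:E)%E.

Let ss_ge0 n l : 0 <= ss n l. Proof. by rewrite mulr_ge0 ?powR_ge0. Qed.

Let S_lty n : (S n < +oo)%E.
Proof.
have kp := summable_powR p1 (fun n => ltW (k_gt0 n)) k_sum.
have kp0 l : (0 <= (k l `^ p)%:E)%E by rewrite lee_fin powR_ge0.
apply: (@le_lt_trans _ _ (\sum_(l <oo) ((k l `^ p)%:E + (k (l + n)%N `^ p)%:E))%E).
  apply: lee_nneseries => l; first by move=> _ _; rewrite lee_fin.
  move=> _; rewrite -EFinD lee_fin /ss.
  have sq (x : R) : x `^ h * x `^ h = x `^ p \/ x <= 0.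
    have [|x0] := leP x 0; first by right.
    by left; rewrite -powRD ?(gt_eqF x0) ?implybT// -splitr.
  have [kk|/ltW kk] := leP (k l) (k (l + n)%N).
    apply: (@le_trans _ _ (k (l + n)%N `^ p)); last by rewrite lerDr powR_ge0.
    have [<-|] := sq (k (l + n)%N); last by rewrite leNgt k_gt0.
    by rewrite ler_wpM2r ?powR_ge0// ge0_ler_powR ?nnegrE// ltW.
  apply: (@le_trans _ _ (k l `^ p)); last by rewrite lerDl powR_ge0.
  have [<-|] := sq (k l); last by rewrite leNgt k_gt0.
  by rewrite ler_wpM2l ?powR_ge0// ge0_ler_powR ?nnegrE// ltW.
rewrite nneseriesD//.
rewrite lte_add_pinfty//.
rewrite (@nneseries_addn _ (fun l => (k l `^ p)%:E) n)//.
apply: le_lt_trans kp.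
by rewrite [leRHS](nneseries_split 0 n)// add0n leeDr// sume_ge0.
Qed.

Lemma iter_adjointE n (y : dual E) (z : E) : iter n (adjoint T_cont) y z = y (iter n T z).
Proof. by elim: n z => // n IH z; rewrite iterS iterSr -IH. Qed.

Lemma iter_shift_basis n m :
  iter n T (lp_basis p1 m) =
  if (m < n)%N then 0 else (k (m - n)%N / k m)%:C *: lp_basis p1 (m - n).
Proof.
apply: lp_eqP => j; rewrite (iter_shift_coord k_gt0 kS T_cont T_e0 T_eS) lp_basisE.
case: ltnP => mn.
  rewrite lp0E; case: eqVneq => [jm|_]; last by rewrite mulr0.
  by move: mn; rewrite -jm ltnNge leq_addl.
rewrite lpZE lp_basisE /GRing.scale/=.
have -> : (j + n == m)%N = (j == m - n)%N by rewrite -(eqn_add2r n j) subnK.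
case: eqVneq => [->|_]; last by rewrite !mulr0.
by rewrite subnK.
Qed.

(** [iter n T] maps the [m]-th basis vector to [k (m - n) / k m] times the one of
    index [m - n], so that the factor [k m] cancels. *)
Lemma dual_coef_iter_adjoint n (y : dual E) b m :
  k m * dual_coef (iter n (adjoint T_cont) y) (b, m) =
  if (m < n)%N then 0 else k (m - n)%N * dual_coef y (b, (m - n)%N).
Proof.
have /in_dualP[ly _] := dual_funP y.
have yZ (a : R[i]) z : y (a *: z) = a *: y z.
  have y0 : y 0 = 0 by have := ly (-1) 0 0; rewrite scaler0 addr0 scaleN1r addNr.
  by have := ly a z 0; rewrite y0 !addr0.
have km : k m != 0 by rewrite gt_eqF.
rewrite /dual_coef /= iter_adjointE iter_shift_basis.
case: ltnP => mn.
  by rewrite -(scale0r (0 : E)) yZ scale0r; case: b; rewrite /= ?oppr0 mulr0.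
rewrite yZ; case: (y _) => c d; case: b => /=.
  by rewrite mul0r subr0 mulrA mulrCA mulfV// mulr1.
by rewrite mul0r addr0 -!mulrN mulrA mulrCA mulfV// mulr1.
Qed.

Let D : R := 2 `^ (2 - p) * M p.
Let D_ge0 : 0 <= D. Proof. by rewrite mulr_ge0 ?powR_ge0// levy_moment_ge0. Qed.

(** Termwise application of the scalar bound assumed on [F]; the terms of index less
    than [n] vanish, and the others are reindexed by [l = m - n]. *)
Let log_series_codiff (F : R -> R) (x y y' : dual E) n :
  (forall z : dual E, cvgn (series (log_term k F z))) ->
  (forall s t, `|F (s - t) - F s - F (- t)| <=
     2 `^ (2 - p) * `|s| `^ h * `|t| `^ h * M p) ->
  y' = iter n (adjoint T_cont) y ->
  (`|log_series k F (x - y') - log_series k F x - log_series k F (- y')|%:E <=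
   (2 * D * (rnorm x `^ h * rnorm y `^ h))%:E * S n)%E.
Proof.
move=> cF Fcodiff y'E.
pose u m := log_term k F (x - y') m - log_term k F x m - log_term k F (- y') m.
pose v m := if (m < n)%N then 0 else
  2 * D * (rnorm x `^ h * rnorm y `^ h) * (k (m - n)%N `^ h * k m `^ h).
have uv m : `|u m| <= v m.
  have hi b : `|F (k m * dual_coef (x - y') (b, m)) - F (k m * dual_coef x (b, m)) -
      F (k m * dual_coef (- y') (b, m))| <= v m / 2.
    rewrite dual_coefB dual_coefN mulrBr mulrN.
    apply: (le_trans (Fcodiff _ _)); rewrite y'E dual_coef_iter_adjoint /v.
    case: ltnP => mn; first by rewrite normr0 powR0 ?gt_eqF// mulr0 !mul0r.
    rewrite !normrM (gtr0_norm (k_gt0 m)) (gtr0_norm (k_gt0 (m - n))).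
    rewrite !powRM ?(ltW (k_gt0 _))//.
    have -> : 2 * D * (rnorm x `^ h * rnorm y `^ h) * (k (m - n)%N `^ h * k m `^ h) / 2 =
      2 `^ (2 - p) * (k m `^ h * rnorm x `^ h) * (k (m - n)%N `^ h * rnorm y `^ h) * M p.
      by rewrite /D; field.
    rewrite ler_wpM2r ?levy_moment_ge0// ler_pM ?mulr_ge0 ?powR_ge0//.
      rewrite ler_wpM2l ?powR_ge0// ler_wpM2l ?powR_ge0// ge0_ler_powR ?nnegrE ?rnorm_ge0 ?(ltW h_gt0)//.
      exact: dual_coef_le.
    rewrite ler_wpM2l ?powR_ge0// ge0_ler_powR ?nnegrE ?rnorm_ge0 ?(ltW h_gt0)//.
    exact: dual_coef_le.
  have := hi true; have := hi false; rewrite /u /log_term.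
  set a1 := F _; set a2 := F _; set a3 := F _ => h1.
  set b1 := F _; set b2 := F _; set b3 := F _ => h2.
  have -> : b1 + a1 - (b2 + a2) - (b3 + a3) = (b1 - b2 - b3) + (a1 - a2 - a3) by ring.
  by apply: (le_trans (ler_normD _ _)); lra.
have v0 m : 0 <= v m by exact: le_trans (uv m).
have sumv : (\sum_(m <oo) (v m)%:E = (2 * D * (rnorm x `^ h * rnorm y `^ h))%:E * S n)%E.
  rewrite (nneseries_split 0 n); last by move=> m _; rewrite lee_fin.
  rewrite add0n big_nat_cond big1 ?add0e; last first.
    by move=> m /andP[/andP[_ mn] _]; rewrite /v mn.
  rewrite -(@nneseries_addn _ (fun m => (v m)%:E) n); last by move=> m; rewrite lee_fin.
  rewrite /S -nneseriesZl; last by move=> m _; rewrite lee_fin.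
  apply: eq_eseriesr => l _; rewrite -EFinM; congr EFin.
  by rewrite /v ltnNge leq_addl /= addnK.
have [|cu bu] := dominated_series uv.
  rewrite sumv lte_mul_pinfty//.
  rewrite lee_fin; apply: mulr_ge0; first exact: mulr_ge0.
  by rewrite mulr_ge0 ?powR_ge0.
rewrite -sumv; apply: le_trans bu.
rewrite /log_series -limB// -limB//; last by apply: is_cvgB.
have -> : series u = series (log_term k F (x - y')) - series (log_term k F x) -
    series (log_term k F (- y')).
  by apply/funext => N; rewrite !fctE /series/= -!sumrB.
by [].
Qed.

Let K : R := 2 `^ (5 - p) * M p.

(** The modulus is bounded by the sum of the absolute values of the real and
    imaginary parts, each of which is estimated by [log_series_codiff]. *)
Lemma codiff_eq_le (x y : dual E) n :
  ((rnorm (codiff_eq mu x (iter n (adjoint T_cont) y) : R[i]^o))%:E <=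
   (K * (rnorm x `^ h * rnorm y `^ h))%:E * S n)%E.
Proof.
rewrite /codiff_eq (clog_charfunctional alpha0 alpha1 a_m0 a_p0 l_m0 l_p0 k_gt0 k_sum nu_ts mu_cyl).
set y' := iter n (adjoint T_cont) y.
have hA := log_series_codiff x (log_charf_cvgA alpha0 alpha1 a_m0 a_p0 l_m0 l_p0 k_gt0 k_sum)
  (psi_re_codiff alpha0 alpha1 a_m0 a_p0 l_m0 l_p0 p1 p2) (erefl y').
have hB := log_series_codiff x (log_charf_cvgB alpha0 alpha1 a_m0 a_p0 l_m0 l_p0 k_gt0 k_sum)
  (psi_im_codiff alpha0 alpha1 a_m0 a_p0 l_m0 l_p0 p1 p2) (erefl y').
apply: (@le_trans _ _ (`|log_series k A (x - y') - log_series k A x - log_series k A (- y')|%:E +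
  `|log_series k B (x - y') - log_series k B x - log_series k B (- y')|%:E)%E).
  by rewrite -EFinD lee_fin; exact: (le_trans (rnorm_le_ReIm _)).
apply: (le_trans (leeD hA hB)).
have S0 : (0 <= S n)%E by apply: nneseries_ge0 => l _ _; rewrite lee_fin.
have Sf : S n \is a fin_num by rewrite ge0_fin_numE.
rewrite -(fineK Sf) -!EFinM -EFinD lee_fin.
have N0 : 0 <= rnorm x `^ h * rnorm y `^ h by rewrite mulr_ge0 ?powR_ge0.
rewrite -mulrDl ler_wpM2r ?fine_ge0// -mulrDl ler_wpM2r//.
(* The real and the imaginary part contribute [2 D] each. *)
have -> : 2 * D + 2 * D = 2 `^ (2 + (2 - p)) * M p.
  rewrite powRD ?pnatr_eq0 ?implybT// (powR_mulrn 2 (ler0n _ 2)) /D; ring.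
rewrite /K ler_wpM2r ?levy_moment_ge0// ler_powR ?ler1n// addrA lerB//.
by rewrite -natrD ler_nat.
Qed.

(** Both sides involve the functionals [x + i y], [x] and [i y]; thus one bound
    serves for the two codifferences. *)
Lemma codiff_neqE (x y : dual E) : codiff_neq mu x y = codiff_eq mu x (- ('i *: y)).
Proof. by rewrite /codiff_neq /codiff_eq opprK. Qed.

Let iter_adjointZ n (c : R[i]) (y : dual E) :
  iter n (adjoint T_cont) (c *: y) = c *: iter n (adjoint T_cont) y.
Proof.
apply: val_inj; apply/funext => z.
rewrite /= iter_adjointE.
by rewrite [RHS]/= -[RHS]/(c *: iter n (adjoint T_cont) y z) iter_adjointE.
Qed.

Lemma codiff_neq_le (x y : dual E) n :
  ((rnorm (codiff_neq mu x (iter n (adjoint T_cont) y) : R[i]^o))%:E <=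
   (K * (rnorm x `^ h * rnorm y `^ h))%:E * S n)%E.
Proof.
rewrite codiff_neqE -scaleNr -iter_adjointZ.
have -> : rnorm y = rnorm (- 'i *: y).
  by rewrite rnormZ rnormN rnormCE /= expr0n add0r expr1n sqrtr1 mul1r.
exact: codiff_eq_le.
Qed.

Let normalized_sup_bound (C : dual E -> dual E -> R[i]) n :
  (forall x y, ((rnorm (C x y : R[i]^o))%:E <= (K * (rnorm x `^ h * rnorm y `^ h))%:E * S n)%E) ->
  (normalized_sup h C <= K%:E * S n)%E.
Proof.
move=> hC; apply: ge_ereal_sup => _ [[x y] [/= x0 y0] <-].
have S0 : (0 <= S n)%E by apply: nneseries_ge0 => l _ _; rewrite lee_fin.
have Sf : S n \is a fin_num by rewrite ge0_fin_numE.
have pos (z : dual E) : z != 0 -> 0 < rnorm z `^ h.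
  move=> z0; rewrite powR_gt0// lt_neqAle rnorm_ge0 andbT eq_sym.
  by apply: contra_neq z0 => /rnorm_eq0.
have := hC x y; rewrite -(fineK Sf) -!EFinM !lee_fin => hxy.
by rewrite ler_pdivrMr ?mulr_gt0 ?pos// mulrAC.
Qed.

Lemma normalized_sup_codiff n :
  (normalized_sup h (fun x y => codiff_eq mu x (iter n (adjoint T_cont) y)) <= K%:E * S n)%E /\
  (normalized_sup h (fun x y => codiff_neq mu x (iter n (adjoint T_cont) y)) <= K%:E * S n)%E.
Proof.
split; apply: normalized_sup_bound => x y; first exact: codiff_eq_le.
exact: codiff_neq_le.
Qed.

End codifference_of_series.

Section backward_weights_facts.
Context {R : realType}.
Variables (k0 : R) (w : nat -> R).
Hypotheses (k0_gt0 : 0 < k0) (w_gt0 : forall n, 0 < w n).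
Notation k := (backward_weights k0 w).

Lemma backward_weights_gt0 n : 0 < k n.
Proof. by rewrite mulr_gt0// prodr_gt0// => l _; rewrite invr_gt0. Qed.

Lemma backward_weightsS n : k n = w n * k n.+1.
Proof.
by rewrite /backward_weights big_ord_recr/= mulrCA [w n * _]mulrC mulfVK// gt_eqF.
Qed.

(** The [alpha]-th powers are summable and [1 <= alpha^-1]. *)
Lemma backward_weights_summable (alpha : R) : 0 < alpha -> alpha < 1 ->
  finite_norm counting alpha%:E k -> (\sum_(n <oo) (k n)%:E < +oo)%E.
Proof.
move=> a0 a1; rewrite /finite_norm Lnorm_counting//.
under eq_eseriesr do rewrite /= (gtr0_norm (backward_weights_gt0 _)).
set S := (\sum_(_ <= n <oo) _)%E => Sp.
have S0 : (0 <= S)%E by apply: nneseries_ge0 => n _ _; rewrite lee_fin powR_ge0.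
have Soo : (S < +oo)%E.
  case: S S0 Sp => [r| |]//= _; first by move=> _; rewrite ltry.
  by rewrite invr_eq0 gt_eqF.
have ia : 1 <= alpha^-1 by rewrite invf_ge1// ltW.
have := summable_powR ia (fun n => powR_ge0 (k n) alpha) Soo.
by under eq_eseriesr do rewrite -powRrM mulfV ?(gt_eqF a0)// powRr1 ?(ltW (backward_weights_gt0 _))//.
Qed.

End backward_weights_facts.

(** * Invariance, codifference bound and mixing *)

Theorem proposition6p4 (R : realType)
  (alpha : R) (alpha0 : 0 < alpha) (alpha1 : alpha < 1)
  (p : R) (p1 : 1 <= p) (p2 : p <= 2)
  (a_m a_p l_m l_p : R) (a_m0 : 0 < a_m) (a_p0 : 0 < a_p)
  (l_m0 : 0 < l_m) (l_p0 : 0 < l_p)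
  (w : nat -> R) (w_gt0 : forall n, 0 < w n)
  (w_bounded : exists M : R, forall n, w n <= M)
  (k0 : R) (k0_gt0 : 0 < k0)
  (k_alpha : finite_norm counting alpha%:E (backward_weights k0 w))
  (nu : probability (measurableTypeR R) R)
  (nu_ts : tempered_stable alpha a_m a_p l_m l_p nu)
  (d : measure_display) (Omega : measurableType d) (P : probability Omega R)
  (th1 th2 : nat -> {RV P >-> R})
  (th_indep : mutually_independent
     (fun bn : bool * nat => if bn.1 then th1 bn.2 else th2 bn.2))
  (th1_law : forall n, same_law nu (th1 n))
  (th2_law : forall n, same_law nu (th2 n))
  (T : {linear lp p1 -> lp p1}) (T_cont : continuous T)
  (T_e0 : T (lp_basis p1 0) = 0)
  (T_eS : forall n, T (lp_basis p1 n.+1) = (w n)%:C *: lp_basis p1 n) :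
  let k := backward_weights k0 w in
  let S n := (\sum_(l <oo) (k l `^ (p / 2) * k (l + n)%N `^ (p / 2))%:E)%E in
  let K := 2 `^ (5 - p) *
    (a_m * l_m `^ (alpha - p) + a_p * l_p `^ (alpha - p)) * GammaR (p - alpha) in
  (exists X : {RV P >-> borel (lp p1)}, is_series_sum k th1 th2 X) /\
  forall X : {RV P >-> borel (lp p1)}, is_series_sum k th1 th2 X ->
  let mu := distribution P X in
  [/\ invariant_measure mu T,
      forall n,
        (normalized_sup (p / 2)
           (fun x y => codiff_eq mu x (iter n (adjoint T_cont) y))
         <= K%:E * S n)%E /\
        (normalized_sup (p / 2)
           (fun x y => codiff_neq mu x (iter n (adjoint T_cont) y))
         <= K%:E * S n)%E
    & S n @[n --> \oo] --> 0%E -> mixing mu T].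
Proof.
move=> k S K.
have k_gt0 n : 0 < k n by exact: backward_weights_gt0.
have kS n : k n = w n * k n.+1 by exact: backward_weightsS.
have k_sum : (\sum_(n <oo) (k n)%:E < +oo)%E.
  exact: (backward_weights_summable k0_gt0 w_gt0 alpha0 alpha1 k_alpha).
have nu1 := nu_first_moment alpha0 alpha1 a_m0 a_p0 l_m0 l_p0 nu_ts.
split; first exact: (exists_series_sum k_gt0 k_sum nu1 th1_law th2_law).
move=> X X_sum mu.
have mu_cyl := series_law_cylinder th_indep th1_law th2_law X_sum.
split.
- exact: (shift_invariant k_gt0 kS T_cont T_e0 T_eS mu_cyl).
- move=> n; rewrite /K -mulrA.
  exact: (normalized_sup_codiff p2 alpha0 alpha1 a_m0 a_p0 l_m0 l_p0 k_gt0 k_sum kS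
    T_cont T_e0 T_eS nu_ts mu_cyl n).
- by move=> _; exact: (shift_mixing k_gt0 kS T_cont T_e0 T_eS mu_cyl).
Qed.
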